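(* The eigenfunctions and eigenvalues of the interaction operator $U\eta(p)=\int_{\mathbb{S}^2}k_O(p\cdot q)\eta(q)\,dq$ associated to the Onsager kernel $k_O(p\cdot q)=\sqrt{1-(p\cdot q)^2}$ are given by the spherical harmonics $$\{Y_s^n\in L^2(\mathbb{S}^2): s\in\mathbb{N}\text{ even},\ -s\le n\le s\}$$ and $$\mu_O(s)=\begin{cases}-\dfrac{\pi\,\Gamma\left(\frac s2+\frac12\right)\Gamma\left(\frac s2-\frac12\right)}{2\,\Gamma\left(\frac s2+1\right)\Gamma\left(\frac s2+2\right)}&\text{if }s\text{ is even},\\[2mm]0&\text{if }s\text{ is odd},\end{cases}$$ where $UY_s^n=\mu_O(s)Y_s^n$.
   Context: $\mathbb{S}^2\subset\mathbb{R}^3$ is the unit sphere with surface measure $dq$. $\mathbb{N}=\{0,1,2,\dots\}$. $Y_s^n$ ($s\in\mathbb{N}$, $-s\le n\le s$) are the usual complex spherical harmonics of degree $s$ and order $n$, an orthonormal basis of $L^2(\mathbb{S}^2)$: $Y_l^m(\varphi,\theta)=N_{lm}e^{im\varphi}P_l^m(\cos\theta)$ with $N_{lm}=(-1)^m\left(\frac{2l+1}{4\pi}\frac{(l-m)!}{(l+m)!}\right)^{1/2}$ and $P_l^m(\mu)=\frac{1}{2^ll!}(1-\mu^2)^{m/2}\frac{d^{l+m}}{d\mu^{l+m}}(\mu^2-1)^l$. $\Gamma$ is the gamma function. The spherical harmonics of odd degree lie in the kernel of $U$ (eigenvalue $0$). *)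

(* Defs.v *)
(* MathComp-Analysis, over an arbitrary [R : realType]; complex numbers are
   [R[i]] from mathcomp-real-closed. *)
From HB Require Import structures.
From mathcomp Require Import all_boot all_order all_algebra.
From mathcomp Require Import all_classical all_reals all_analysis measurable_realfun.
From mathcomp Require Import complex.

Set Implicit Arguments.
Unset Strict Implicit.
Unset Printing Implicit Defensive.

Import Order.TTheory GRing.Theory Num.Theory.
Import numFieldNormedType.Exports.

Local Open Scope classical_set_scope.
Local Open Scope ring_scope.
Local Open Scope complex_scope.

Section Sphere.
Context {R : realType}.

(* R^3 is [R * R * R]: it carries the product (Borel) sigma-algebra. *)
Definition dot3 (p q : R * R * R) : R :=
  p.1.1 * q.1.1 + p.1.2 * q.1.2 + p.2 * q.2.

Definition S2 : set (R * R * R) := [set p | dot3 p p = 1].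

(* [a] is the pair (phi, theta) of azimuth and polar angle. *)
Definition sphere_pt (a : R * R) : R * R * R :=
  (sin a.2 * cos a.1, sin a.2 * sin a.1, cos a.2).

Definition angle_domain : set (R * R) := `[0, 2 * pi] `*` `[0, pi].

(* dq = sin(theta) dphi dtheta *)
Definition surface_measure (A : set (R * R * R)) : \bar R :=
  (\int[lebesgue_measure \x lebesgue_measure]_
      (a in angle_domain `&` sphere_pt @^-1` A) (sin a.2)%:E)%E.

Lemma measurable_sphere_pt : measurable_fun setT sphere_pt.
Proof.
have msin : measurable_fun setT (@sin R).
  by apply: continuous_measurable_fun; exact: continuous_sin.
have mcos : measurable_fun setT (@cos R).
  by apply: continuous_measurable_fun; exact: continuous_cos.
apply: measurable_fun_pair; [apply: measurable_fun_pair|].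
- by apply: measurable_funM; apply: measurableT_comp.
- by apply: measurable_funM; apply: measurableT_comp.
- exact: measurableT_comp.
Qed.

Let measurable_dom A : measurable A ->
  measurable (angle_domain `&` sphere_pt @^-1` A).
Proof.
move=> mA; apply: measurableI; first exact: measurableX.
by rewrite -[X in measurable X]setTI; exact: measurable_sphere_pt.
Qed.

Let sin_dom_ge0 (A : set (R * R)) a :
  (angle_domain `&` A) a -> (0 <= (sin a.2)%:E)%E.
Proof. by case=> -[_ a2] _; rewrite lee_fin; apply: sin_ge0_pi. Qed.

Let surface_measure0 : surface_measure set0 = 0%E.
Proof. by rewrite /surface_measure preimage_set0 setI0 integral_set0. Qed.

Let surface_measure_ge0 A : (0 <= surface_measure A)%E.
Proof. by apply: integral_ge0 => a; exact: sin_dom_ge0. Qed.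

Let surface_measure_sigma_additive : semi_sigma_additive surface_measure.
Proof.
move=> /= F mF tF mUF; apply: cvg_toP.
  apply: ereal_nondecreasing_is_cvgn => m n mn.
  by apply: lee_sum_nneg_natr => // k _ _.
rewrite /surface_measure preimage_bigcup setI_bigcupr ge0_integral_bigcup//=.
- by move=> n; exact: measurable_dom.
- apply: measurable_funTS; apply/measurable_EFinP.
  apply: measurableT_comp => //.
  by apply: continuous_measurable_fun; exact: continuous_sin.
- by move=> a [n _]; exact: sin_dom_ge0.
- apply/trivIsetP => i j _ _ ij; rewrite setIACA -preimage_setI.
  by move/trivIsetP : tF => ->//; rewrite preimage_set0 setI0.
Qed.

HB.instance Definition _ := isMeasure.Build _ _ _ surface_measure
  surface_measure0 surface_measure_ge0 surface_measure_sigma_additive.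

Definition polar (p : R * R * R) : R := acos p.2.

(* The azimuth in [0, 2 pi[; at the poles its value is an arbitrary number,
   on which the spherical harmonics do not depend. *)
Definition azimuth (p : R * R * R) : R :=
  let t := acos (p.1.1 / Num.sqrt (p.1.1 ^+ 2 + p.1.2 ^+ 2)) in
  if 0 <= p.1.2 then t else 2 * pi - t.

Lemma sphere_pt_angles (p : R * R * R) :
  S2 p -> sphere_pt (azimuth p, polar p) = p.
Proof.
case: p => -[x y] z; rewrite /S2 /dot3 /sphere_pt /azimuth /polar /=.
rewrite -!expr2 => p1.
have xy0 : 0 <= x ^+ 2 + y ^+ 2 by rewrite addr_ge0 ?sqr_ge0.
have z2 : z ^+ 2 <= 1 by rewrite -p1 lerDr.
have zitv : -1 <= z <= 1 by rewrite -ler_norml -(@expr_le1 _ 2)// real_normK ?num_real.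
rewrite sin_acos// acosK ?in_itv//=.
have -> : 1 - z ^+ 2 = x ^+ 2 + y ^+ 2 by rewrite -p1 addrK.
set r := Num.sqrt _.
have r2 : r ^+ 2 = x ^+ 2 + y ^+ 2 by rewrite sqr_sqrtr.
have [r0|r0] := eqVneq r 0.
  have /eqP : x ^+ 2 + y ^+ 2 = 0 by rewrite -r2 r0 expr0n.
  rewrite paddr_eq0 ?sqr_ge0// !sqrf_eq0 => /andP[/eqP-> /eqP->].
  by rewrite r0 !mul0r.
have rgt0 : 0 < r by rewrite lt_neqAle eq_sym r0 sqrtr_ge0.
have xr : -1 <= x / r <= 1.
  rewrite -ler_norml normrM normfV (gtr0_norm rgt0) ler_pdivrMr// mul1r.
  by rewrite -sqrtr_sqr ler_wsqrtr// lerDl sqr_ge0.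
have ry : r * Num.sqrt (1 - (x / r) ^+ 2) = `|y|.
  rewrite -{1}(gtr0_norm rgt0) -(sqrtr_sqr r) -sqrtrM ?sqr_ge0//.
  rewrite mulrBr mulr1 -exprMn (mulrC r) divfK// r2 addrAC subrr add0r.
  by rewrite sqrtr_sqr.
have cE : cos (if 0 <= y then acos (x / r) else 2 * pi - acos (x / r)) = x / r.
  case: ifP => _; first by rewrite acosK ?in_itv.
  by rewrite (mulrC 2) mulr_natr addrC cosD2pi cosN acosK ?in_itv.
have sE : r * sin (if 0 <= y then acos (x / r) else 2 * pi - acos (x / r)) = y.
  case: (leP 0 y) => y0; first by rewrite sin_acos// ry ger0_norm.
  rewrite (mulrC 2) mulr_natr addrC sinD2pi sinN sin_acos// mulrN ry.
  by rewrite ltr0_norm// opprK.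
by rewrite cE sE (mulrC r) divfK.
Qed.

End Sphere.

Section Gamma.
Context {R : realType}.

Definition Euler_integral (x : R) : R :=
  \int[lebesgue_measure]_(t in `]0, +oo[) (t `^ (x - 1) * expR (- t)).

(* Euler's integral for x > 0, continued to non-integral x < 0 by the functional
   equation Gamma (x + n) = x (x + 1) ... (x + n - 1) Gamma x, with n such that
   0 < x + n; the values at the poles 0, -1, -2, ... are meaningless. *)
Definition Gamma (x : R) : R :=
  let n := if 0 < x then 0%N else `|Num.floor x|%N.+1 in
  Euler_integral (x + n%:R) / \prod_(k < n) (x + k%:R).

End Gamma.

Section SphericalHarmonics.
Context {R : realType}.

(* Legendre functions and spherical harmonics are meant for - l <= m <= l; the
   order m is a signed integer, so that l + m and l - m below are nonnegative
   elements of int, turned into nat by the absolute value. [powR] has 0 `^ 0 = 1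
   and 0 `^ a = 0 for any a != 0 (also a < 0), so that at mu = 1 and mu = -1
   the value is 0 unless m = 0, which is the continuous extension. *)
Definition assoc_legendre (l : nat) (m : int) (mu : R) : R :=
  (2 ^+ l * l`!%:R)^-1 * (1 - mu ^+ 2) `^ (m%:~R / 2)
  * ((('X ^+ 2 - 1) ^+ l : {poly R})^`(`|(l%:Z + m)%R|%N)).[mu].

Definition sph_norm (l : nat) (m : int) : R :=
  (-1) ^ m * Num.sqrt ((2 * l%:R + 1) / (4 * pi)
                       * (`|(l%:Z - m)%R|%N`!%:R / `|(l%:Z + m)%R|%N`!%:R)).

(* e^{i x} *)
Definition expi (x : R) : R[i] := cos x +i* sin x.

Definition Ylm_angles (l : nat) (m : int) (phi theta : R) : R[i] :=
  (sph_norm l m)%:C * expi (m%:~R * phi) * (assoc_legendre l m (cos theta))%:C.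

Definition Ylm (l : nat) (m : int) (p : R * R * R) : R[i] :=
  Ylm_angles l m (azimuth p) (polar p).

End SphericalHarmonics.

Section Operator.
Context {R : realType}.
Implicit Types (f g eta : R * R * R -> R[i]).

Definition sphere_integral f : R[i] :=
  (\int[surface_measure]_(q in S2) complex.Re (f q))
  +i* (\int[surface_measure]_(q in S2) complex.Im (f q)).

(* Elements of L^2(S^2) are represented by functions, of which only the values
   on S^2 matter, and equality in L^2(S^2) is [ae_eqS2]. *)
Definition L2S2 f : Prop :=
  [/\ measurable_fun S2 (fun q => complex.Re (f q)),
      measurable_fun S2 (fun q => complex.Im (f q)) &
      (\int[surface_measure]_(q in S2)
          ((complex.Re (f q)) ^+ 2 + (complex.Im (f q)) ^+ 2)%:E < +oo)%E].

Definition ae_eqS2 f g : Prop :=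
  {ae surface_measure, forall q, S2 q -> f q = g q}.

Definition onsager (t : R) : R := Num.sqrt (1 - t ^+ 2).

Definition interaction eta (p : R * R * R) : R[i] :=
  sphere_integral (fun q => (onsager (dot3 p q))%:C * eta q).

Definition eigenfunction (lambda : R[i]) eta : Prop :=
  [/\ L2S2 eta, ~ ae_eqS2 eta (fun=> 0) &
      ae_eqS2 (interaction eta) (fun p => lambda * eta p)].

End Operator.

Definition mu_O {R : realType} (s : nat) : R :=
  if odd s then 0
  else - (pi * Gamma (s%:R / 2 + 1 / 2) * Gamma (s%:R / 2 - 1 / 2)
          / (2 * Gamma (s%:R / 2 + 1) * Gamma (s%:R / 2 + 2))).

(* Main.v *)
From HB Require Import structures.
Require Import Defs.
From mathcomp Require Import all_boot all_order all_algebra.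
From mathcomp Require Import all_classical all_reals all_analysis measurable_realfun.
From mathcomp Require Import complex zify ring lra.

Set Implicit Arguments.
Unset Strict Implicit.
Unset Printing Implicit Defensive.

Import Order.TTheory GRing.Theory Num.Theory.
Import numFieldNormedType.Exports.

Local Open Scope classical_set_scope.
Local Open Scope ring_scope.
Local Open Scope complex_scope.

(** Let v(c) = (i (c^2 + 1) / 2, (1 - c^2) / 2, c), a curve of isotropic vectors
    of C^3. The coefficients of the powers of c in (v(c) . q)^s are, up to
    nonzero factors, the 2 s + 1 spherical harmonics of degree s: this is
    Rodrigues' formula read as a Taylor expansion ([harm_rodrigues],
    [Ylm_harm]).

    Eigenfunctions. In polar coordinates one finds, for every w in C^3, that the
    integral of (w . q)^N over the sphere is 4 pi / (N + 1) (w . w)^(N / 2) if N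
    is even and 0 if N is odd ([sphere_integral_linform_pow]). For p on the
    sphere and w = p + t v(c) one has w . w = 1 + 2 t v(c) . p. Comparing the
    coefficients of t^s, the integral of (p . q)^m (v(c) . q)^s over q is a
    multiple of (v(c) . p)^s, which is the Funk-Hecke formula for the kernel
    (p . q)^m ([funk_hecke_monomial]). The Onsager kernel is a uniform limit of
    polynomials in p . q and inherits the formula ([funk_hecke_onsager]).

    Eigenvalues. Evaluated at the north pole, the formula gives the eigenvalue
    2 pi I_s, with I_s the integral of sin^2 x P_s(cos x) over [0, pi]
    ([interaction_pole]). The recurrences between Legendre polynomials and an
    integration by parts yield (s + 2) (s + 4) I_(s+2) = (s + 1) (s - 1) I_s
    ([legendre_int_rec]). The quotient of Gamma values obeys the same recurrence
    with the same start ([mu_O_legendre]). The recurrence also shows that the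
    eigenvalues of even degree are nonzero with strictly decreasing absolute
    values, hence distinct ([mu_O_inj]).

    Nothing else. Let f be an eigenfunction for lambda <> 0. As U is symmetric,
    f is orthogonal, for the bilinear pairing, to the harmonics of every degree
    s whose eigenvalue differs from lambda ([eigen_orthogonal]). If lambda is
    the eigenvalue of degree s, subtract from f its component of degree s; it is
    read off from the Gram matrix of that degree, which is antidiagonal and
    invertible ([gram_harm]). The remainder is orthogonal to all harmonics,
    hence to all powers (p . q)^m ([orthogonal_dot3_pow]), hence to the kernel;
    so U annihilates it, and an eigenfunction for lambda <> 0 that U annihilates
    vanishes almost everywhere ([eigen_trivial]). *)

(** * The surface measure in polar coordinates *)

Section ChangeOfVariables.
Context {R : realType}.
Local Notation leb2 := (@lebesgue_measure R \x @lebesgue_measure R)%E.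
Local Notation sigma := (@surface_measure R).
Local Notation T3 := (R * R * R)%type.

Lemma continuous_measurableR (f : R -> R) : continuous f -> measurable_fun setT f.
Proof. exact: continuous_measurable_fun. Qed.

Lemma measurable_sin : measurable_fun setT (@sin R).
Proof. by apply: continuous_measurableR; exact: continuous_sin. Qed.

Lemma measurable_cos : measurable_fun setT (@cos R).
Proof. by apply: continuous_measurableR; exact: continuous_cos. Qed.

Lemma measurable_angle_domain : measurable (@angle_domain R).
Proof. exact: measurableX. Qed.

Let density (a : R * R) : R := sin a.2.

Let mdensity : measurable_fun (@angle_domain R) (EFin \o density).
Proof.
by apply: measurable_funTS; apply/measurable_EFinP; apply: measurableT_comp => //;
  exact: measurable_sin.
Qed.

Let density_ge0 a : angle_domain a -> (0 <= (density a)%:E)%E.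
Proof. by case=> _ a2; rewrite lee_fin; apply: sin_ge0_pi. Qed.

Let mcomp (f : T3 -> \bar R) : measurable_fun setT f ->
  measurable_fun (@angle_domain R) (f \o sphere_pt).
Proof.
move=> mf; apply: measurable_funTS; apply: measurableT_comp => //.
exact: measurable_sphere_pt.
Qed.

Import HBNNSimple.

(** By linearity this is about indicator functions, for which it is the definition
    of the surface measure. *)
Let ge0_nnsfun (h : {nnsfun T3 >-> R}) :
  (\int[sigma]_x (h x)%:E =
   \int[leb2]_(a in angle_domain) ((h (sphere_pt a))%:E * (density a)%:E))%E.
Proof.
have indich r : measurable_fun setT
    (fun x => (r * \1_(h @^-1` [set r]) x)%:E).
  by apply: (measurable_comp measurableT) => //; exact: measurable_funM.
transitivity (\int[sigma]_x
   (\sum_(y \in range h) (y * \1_(h @^-1` [set y]) x)%:E))%E.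
  by apply: eq_integral => t tE; rewrite /= fimfunE -fsumEFin.
rewrite ge0_integral_fsum//; last by move=> m y Ey; exact: nnfun_muleindic_ge0.
transitivity (\int[leb2]_(a in angle_domain) (\sum_(y \in range h)
    (y * \1_(h @^-1` [set y]) (sphere_pt a))%:E * (density a)%:E))%E; last first.
  apply: eq_integral => a; rewrite inE => ad.
  rewrite -ge0_mule_fsuml => [|y]; last exact: nnfun_muleindic_ge0.
  by rewrite fsumEFin // -(fimfunE _ (sphere_pt a)).
rewrite ge0_integral_fsum//; last 3 first.
- exact: measurable_angle_domain.
- move=> y; apply: emeasurable_funM; last exact: mdensity.
  by have := mcomp (indich y).
- by move=> y a ad; rewrite mule_ge0 ?density_ge0// nnfun_muleindic_ge0.
apply: eq_fsbigr => r rhn.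
have mhr : measurable (h @^-1` [set r]) by [].
have r0 : 0 <= r by move: rhn; rewrite inE => -[t _ <-].
under eq_integral do rewrite EFinM.
rewrite integralZl_indic_nnsfun// integral_indic// setIT.
under eq_integral do rewrite EFinM -muleA.
rewrite ge0_integralZl//.
- congr (_ * _)%E.
  rewrite /= /surface_measure integral_mkcondr.
  apply: eq_integral => a _; rewrite epatch_indic muleC.
  by congr (_ * _)%E; rewrite !indicE.
- exact: measurable_angle_domain.
- apply: emeasurable_funM; last exact: mdensity.
  by apply: (@mcomp (EFin \o \1_(h @^-1` [set r]))); apply/measurable_EFinP.
- by move=> t Et; rewrite mule_ge0 ?lee_fin ?density_ge0//; exact: density_ge0.
Qed.

(** Monotone approximation by simple functions. *)
Lemma ge0_integral_sphere (f : T3 -> \bar R) :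
  measurable_fun setT f -> (forall x, (0 <= f x)%E) ->
  (\int[sigma]_x f x =
   \int[leb2]_(a in angle_domain) (f (sphere_pt a) * (sin a.2)%:E))%E.
Proof.
move=> mf f0; pose h := nnsfun_approx measurableT mf.
transitivity (limn (fun n => \int[sigma]_x (h n x)%:E)%E).
  rewrite -monotone_convergence//.
  - apply: eq_integral => y _; apply/esym/cvg_lim => //.
    exact: cvg_nnsfun_approx.
  - by move=> n; exact/measurable_EFinP/measurable_funP.
  - by move=> n y _; rewrite lee_fin.
  - by move=> y _ m n mn; rewrite lee_fin; exact/lefP/nd_nnsfun_approx.
under eq_fun do rewrite ge0_nnsfun.
rewrite -monotone_convergence//.
- apply: eq_integral => a _; apply/cvg_lim => //.
  apply: cvgeZr => //; exact: (cvg_nnsfun_approx measurableT mf).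
- exact: measurable_angle_domain.
- move=> n; apply: emeasurable_funM; last exact: mdensity.
  by apply: (@mcomp (EFin \o h n)); exact/measurable_EFinP/measurable_funP.
- by move=> n a ad; rewrite mule_ge0 ?lee_fin//; exact: density_ge0.
- move=> a ad m n mn; rewrite lee_wpmul2r ?lee_fin//; first exact: density_ge0.
  exact/lefP/nd_nnsfun_approx.
Qed.

Lemma sphere_pt_S2 (a : R * R) : S2 (sphere_pt a).
Proof.
rewrite /S2 /dot3 /sphere_pt /=.
by have := cos2Dsin2 a.1; have := cos2Dsin2 a.2; nra.
Qed.

Lemma measurable_S2 : measurable (@S2 R).
Proof.
have mf : measurable_fun setT (fun p : T3 => dot3 p p).
  rewrite /dot3; apply: measurable_funD; [apply: measurable_funD|];
   apply: measurable_funM => //;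
   by repeat (exact: measurable_fst || exact: measurable_snd || (apply: measurableT_comp)).
by rewrite -[X in measurable X]setTI; apply: (mf measurableT [set 1]).
Qed.

End ChangeOfVariables.

(** * Integrals over the sphere as products of angular integrals *)

Section BoundedIntegrable.
Context d {T : measurableType d} {R : realType}.
Variable mu : {measure set T -> \bar R}.

Lemma integrable_bounded (D : set T) (f : T -> R) (M : R) :
  measurable D -> (mu D < +oo)%E -> measurable_fun D f ->
  (forall x, D x -> `|f x| <= M) -> mu.-integrable D (EFin \o f).
Proof.
move=> mD Doo mf fM; apply: measurable_bounded_integrable => //.
exists M; split; first exact: num_real.
by move=> x Mx y Dy /=; rewrite (le_trans (fM y Dy))// ltW.
Qed.

End BoundedIntegrable.

Section SphereIntegral.
Context {R : realType}.
Local Notation leb := (@lebesgue_measure R).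
Local Notation leb2 := (@lebesgue_measure R \x @lebesgue_measure R)%E.
Local Notation sigma := (@surface_measure R).
Local Notation T3 := (R * R * R)%type.

Lemma angle_domain_finite : (leb2 (@angle_domain R) < +oo)%E.
Proof.
rewrite /angle_domain product_measure1E//= !lebesgue_measure_itv /= !lte_fin.
by rewrite pi_gt0 mulr_gt0 ?pi_gt0// !sube0 -EFinM ltry.
Qed.

Lemma surface_measure_finite : (sigma setT < +oo)%E.
Proof.
rewrite /surface_measure preimage_setT setIT.
have mD := @measurable_angle_domain R.
suff : leb2.-integrable angle_domain (EFin \o (fun a : R * R => sin a.2)).
  by move=> /integrable_fin_num -/(_ mD); rewrite ltey => /fin_numP[_].
apply: (integrable_bounded (M := 1)) => //.
- exact: angle_domain_finite.
- apply: measurable_funTS; apply: measurableT_comp => //; exact: measurable_sin.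
- by move=> x _; rewrite sin_max.
Qed.

HB.instance Definition _ := @Measure_isFinite.Build _ _ R sigma
  (lty_fin_num_fun surface_measure_finite).

Lemma integrable_sphere (f : T3 -> R) (M : R) : measurable_fun S2 f ->
  (forall x, S2 x -> `|f x| <= M) -> sigma.-integrable S2 (EFin \o f).
Proof.
move=> mf fM; apply: (integrable_bounded measurable_S2 _ mf fM).
by rewrite ltey_eq fin_num_measure//; exact: measurable_S2.
Qed.

Let integral_sphereE (f : T3 -> \bar R) : measurable_fun S2 f ->
    (forall p, S2 p -> 0 <= f p)%E ->
  (\int[sigma]_(p in S2) f p =
   \int[leb2]_(a in angle_domain) (f (sphere_pt a) * (sin a.2)%:E))%E.
Proof.
move=> mf f0; rewrite integral_mkcond ge0_integral_sphere.
- apply: eq_integral => a _; rewrite patchE mem_set//; exact: sphere_pt_S2.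
- by apply/(measurable_restrictT _ measurable_S2).
- by move=> p; rewrite patchE; case: ifPn => //; rewrite inE; exact: f0.
Qed.

(** The sine is nonnegative on the angle domain, so multiplying by it commutes with
    taking positive and negative parts. *)
Lemma Rintegral_sphere (f : T3 -> R) : sigma.-integrable S2 (EFin \o f) ->
  \int[sigma]_(p in S2) f p =
  \int[leb2]_(a in angle_domain) (f (sphere_pt a) * sin a.2).
Proof.
move=> intf; rewrite /Rintegral; congr fine.
rewrite [LHS]integralE [RHS]integralE.
have mf := measurable_int _ intf.
rewrite !integral_sphereE//; last 2 first.
- exact: measurable_funeneg.
- exact: measurable_funepos.
congr (_ - _)%E; apply: eq_integral => -[x y]; rewrite inE => -[_ /= y0].
- have s0 : 0 <= sin y by apply: sin_ge0_pi.
  by rewrite !funeposE /= -!EFin_max -EFinM maxr_pMl// mul0r.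
- have s0 : 0 <= sin y by apply: sin_ge0_pi.
  by rewrite !funenegE /= -!EFin_max -EFinM maxr_pMl// mul0r mulNr.
Qed.

(** Fubini's theorem, applied to the extensions of g and h by zero. *)
Lemma Rintegral_leb2_prod (g h : R -> R) (M : R) (A B : set R) :
  measurable A -> measurable B -> (leb A < +oo)%E -> (leb B < +oo)%E ->
  measurable_fun A g -> measurable_fun B h ->
  (forall x, A x -> `|g x| <= M) -> (forall x, B x -> `|h x| <= M) ->
  \int[leb2]_(a in A `*` B) (g a.1 * h a.2) =
  (\int[leb]_(x in A) g x) * (\int[leb]_(x in B) h x).
Proof.
move=> mA mB fA fB mg mh gM hM.
have ig := integrable_bounded (mu := leb) mA fA mg gM.
have ih := integrable_bounded (mu := leb) mB fB mh hM.
pose G := g \_ A; pose H := h \_ B.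
have GHE : (fun a => (g a.1 * h a.2)) \_ (A `*` B) = (fun a => G a.1 * H a.2).
  apply/funext => -[x y]; rewrite /G /H !patchE /=.
  case: (asboolP (A x)) => Ax; case: (asboolP (B y)) => By.
  - by rewrite !mem_set.
  - by rewrite [y \in B]memNset// mulr0 memNset// => -[].
  - by rewrite [x \in A]memNset// mul0r memNset// => -[].
  - by rewrite [x \in A]memNset// mul0r memNset// => -[].
have mG : measurable_fun setT G by apply/(measurable_restrictT _ mA).
have mH : measurable_fun setT H by apply/(measurable_restrictT _ mB).
have iG : leb.-integrable setT (EFin \o G).
  by rewrite /G -restrict_EFin; apply/integrable_restrict => //; rewrite setTI.
have iH : leb.-integrable setT (EFin \o H).
  by rewrite /H -restrict_EFin; apply/integrable_restrict => //; rewrite setTI.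
have iGH : leb2.-integrable setT (fun a => (G a.1 * H a.2)%:E).
  apply/integrable12ltyP.
    apply/measurable_EFinP; apply: measurable_funM; exact: measurableT_comp.
  under eq_integral.
    move=> x _; under eq_integral do rewrite /= normrM EFinM.
    rewrite ge0_integralZl//; last by apply/measurable_EFinP; apply: measurableT_comp.
    over.
  rewrite /= ge0_integralZr//.
  - apply: lte_mul_pinfty.
    + exact: integral_ge0.
    + by apply: integrable_fin_num => //; exact: (integrable_abse iG).
    + by case/integrableP : iH.
  - by apply/measurable_EFinP; apply: measurableT_comp.
  - exact: integral_ge0.
rewrite Rintegral_mkcond GHE.
rewrite [in LHS]/Rintegral -(integral12_prod_meas1 iGH) /fubini_F /=.
under eq_integral.
  move=> x _; under eq_integral do rewrite EFinM.
  rewrite integralZl// -[X in (_ * X)%E]fineK; last exact: integrable_fin_num.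
  over.
rewrite /= integralZr// fineM//; last exact: integrable_fin_num.
by congr (_ * _); rewrite [RHS]Rintegral_mkcond.
Qed.

Lemma Rintegral_sphere_prod (f : T3 -> R) (g h : R -> R) (M : R) :
  sigma.-integrable S2 (EFin \o f) ->
  measurable_fun setT g -> measurable_fun setT h ->
  (forall x, `|g x| <= M) -> (forall x, `|h x| <= M) ->
  (forall a, f (sphere_pt a) = g a.1 * h a.2) ->
  \int[sigma]_(p in S2) f p =
  (\int[leb]_(x in `[0, 2 * pi]) g x) *
  (\int[leb]_(x in `[0, pi]) (h x * sin x)).
Proof.
move=> intf mg mh gM hM fE.
rewrite Rintegral_sphere//.
under eq_Rintegral do rewrite fE -mulrA.
rewrite (@Rintegral_leb2_prod g (fun x => h x * sin x) M)//.
- rewrite lebesgue_measure_itv /= lte_fin mulr_gt0 ?pi_gt0//.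
  by rewrite sube0 ltry.
- by rewrite lebesgue_measure_itv /= lte_fin pi_gt0 sube0 ltry.
- exact: measurable_funTS.
- by apply: measurable_funTS; apply: measurable_funM => //; exact: measurable_sin.
- move=> x _; rewrite normrM (le_trans _ (hM x))// ler_piMr// sin_max//.
Qed.

End SphereIntegral.

(** * Complex-valued integrals over the sphere *)

Section ComplexParts.
Context {R : realType}.
Implicit Types x y : R[i].

Lemma RecD x y : complex.Re (x + y) = complex.Re x + complex.Re y.
Proof. by case: x y => [a b] [c d]. Qed.

Lemma ImcD x y : complex.Im (x + y) = complex.Im x + complex.Im y.
Proof. by case: x y => [a b] [c d]. Qed.

Lemma RecM x y : complex.Re (x * y) =
  complex.Re x * complex.Re y - complex.Im x * complex.Im y.
Proof. by case: x y => [a b] [c d]. Qed.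

Lemma ImcM x y : complex.Im (x * y) =
  complex.Re x * complex.Im y + complex.Im x * complex.Re y.
Proof. by case: x y => [a b] [c d]. Qed.

Lemma normc_le_ReIm x : Normc.normc x <= `|complex.Re x| + `|complex.Im x|.
Proof.
case: x => a b /=; rewrite -[leRHS]ger0_norm ?addr_ge0//.
rewrite -sqrtr_sqr ler_wsqrtr// sqrrD !real_normK ?num_real//.
by rewrite lerD2r lerDl mulrn_wge0// mulr_ge0.
Qed.

Lemma normc_ge0 x : 0 <= Normc.normc x.
Proof. by case: x => a b /=; exact: sqrtr_ge0. Qed.

(** Replacing a kernel by a uniform approximation bounds the defect of an identity
    by e * C for every e; this concludes such arguments. *)
Lemma normc_small_eq0 x (C : R) : (forall e, 0 < e -> Normc.normc x <= e * C) -> x = 0.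
Proof.
move=> h; apply: Normc.eq0_normc; apply/eqP; rewrite eq_le normc_ge0 andbT.
apply/ler_addgt0Pr => e e0; rewrite add0r.
have C1 : 0 < `|C| + 1 by rewrite ltr_wpDl.
have := h (e / (`|C| + 1)) (divr_gt0 e0 C1) => /le_trans; apply.
rewrite mulrAC ler_pdivrMr// ler_wpM2l ?(ltW e0)//.
by rewrite (le_trans (ler_norm C))// lerDl.
Qed.

End ComplexParts.

Section SphereIntegralC.
Context {R : realType}.
Local Notation sigma := (@surface_measure R).
Local Notation T3 := (R * R * R)%type.
Implicit Types (f g eta : T3 -> R[i]) (c : R[i]).

Definition integrableC f :=
  sigma.-integrable S2 (EFin \o (fun q => complex.Re (f q))) /\
  sigma.-integrable S2 (EFin \o (fun q => complex.Im (f q))).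

(** Multipliers of [integrableC], which is not closed under products. *)
Definition boundedC f :=
  [/\ measurable_fun S2 (fun q => complex.Re (f q)),
      measurable_fun S2 (fun q => complex.Im (f q)) &
      exists M : R, forall q, S2 q ->
        `|complex.Re (f q)| <= M /\ `|complex.Im (f q)| <= M].

Let mS2 := @measurable_S2 R.

Lemma boundedC_integrable f : boundedC f -> integrableC f.
Proof.
by case=> mr mi [M fM]; split; apply: (@integrable_sphere R _ M) => // x /fM[].
Qed.

Lemma eq_boundedC f g : (forall q, S2 q -> f q = g q) -> boundedC f -> boundedC g.
Proof.
move=> fg [mr mi [M fM]]; split.
- by apply: eq_measurable_fun mr => q; rewrite inE => /fg ->.
- by apply: eq_measurable_fun mi => q; rewrite inE => /fg ->.
- by exists M => q Sq; rewrite -fg//; exact: fM.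
Qed.

Lemma eq_integrableC f g :
  (forall q, S2 q -> f q = g q) -> integrableC f -> integrableC g.
Proof.
move=> fg [ir ii]; split.
- by apply: eq_integrable ir => // q; rewrite inE /= => /fg ->.
- by apply: eq_integrable ii => // q; rewrite inE /= => /fg ->.
Qed.

Lemma boundedC_cst c : boundedC (fun=> c).
Proof.
split; [exact: measurable_cst..|].
exists (`|complex.Re c| + `|complex.Im c|) => q _.
by rewrite lerDl lerDr !normr_ge0.
Qed.

Lemma boundedCD f g : boundedC f -> boundedC g -> boundedC (fun q => f q + g q).
Proof.
move=> [fr fi [M fM]] [gr gi [N gN]]; split.
- by under eq_fun do rewrite RecD; exact: measurable_funD.
- by under eq_fun do rewrite ImcD; exact: measurable_funD.
- exists (M + N) => q Sq; rewrite RecD ImcD.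
  have [f1 f2] := fM q Sq; have [g1 g2] := gN q Sq.
  by split; rewrite (le_trans (ler_normD _ _))// lerD.
Qed.

Lemma boundedCM f g : boundedC f -> boundedC g -> boundedC (fun q => f q * g q).
Proof.
move=> [fr fi [M fM]] [gr gi [N gN]]; split.
- by under eq_fun do rewrite RecM; apply: measurable_funB; exact: measurable_funM.
- by under eq_fun do rewrite ImcM; apply: measurable_funD; exact: measurable_funM.
- exists (M * N + M * N) => q Sq; rewrite RecM ImcM.
  have [f1 f2] := fM q Sq; have [g1 g2] := gN q Sq.
  split; [rewrite (le_trans (ler_normB _ _))//|rewrite (le_trans (ler_normD _ _))//];
  by rewrite !normrM lerD// ler_pM.
Qed.

Lemma boundedCZ c f : boundedC f -> boundedC (fun q => c * f q).
Proof. by apply: boundedCM; exact: boundedC_cst. Qed.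

Lemma boundedCX f n : boundedC f -> boundedC (fun q => f q ^+ n).
Proof.
move=> bf; elim: n => [|n IH]; first by apply: eq_boundedC (boundedC_cst 1).
by apply: eq_boundedC (boundedCM bf IH) => q _; rewrite exprS.
Qed.

Lemma boundedC_sum (I : Type) (r : seq I) (P : pred I) (F : I -> T3 -> R[i]) :
  (forall i, boundedC (F i)) -> boundedC (fun q => \sum_(i <- r | P i) F i q).
Proof.
move=> bF; elim: r => [|i r IH].
  by apply: eq_boundedC (boundedC_cst 0) => q _; rewrite big_nil.
case Pi: (P i).
  by apply: eq_boundedC (boundedCD (bF i) IH) => q _; rewrite big_cons Pi.
by apply: eq_boundedC IH => q _; rewrite big_cons Pi.
Qed.

Lemma integrableCD f g : integrableC f -> integrableC g ->
  integrableC (fun q => f q + g q).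
Proof.
move=> [fr fi] [gr gi]; split.
- by have := integrableD mS2 fr gr; apply: eq_integrable => // q _; rewrite /= RecD.
- by have := integrableD mS2 fi gi; apply: eq_integrable => // q _; rewrite /= ImcD.
Qed.

Let integrableM (h k : T3 -> R) (M : R) : sigma.-integrable S2 (EFin \o h) ->
  measurable_fun S2 k -> (forall q, S2 q -> `|k q| <= M) ->
  sigma.-integrable S2 (EFin \o (fun q => h q * k q)).
Proof.
move=> ih mk kM.
have bk : [bounded k x | x in S2].
  exists M; split; first exact: num_real.
  by move=> x Mx y Dy /=; rewrite (le_trans (kM y Dy))// ltW.
have := integrableMl mS2 ih mk bk.
by apply: eq_integrable => // q _ /=.
Qed.

Lemma integrableCM f g : integrableC f -> boundedC g ->
  integrableC (fun q => f q * g q).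
Proof.
move=> [fr fi] [gr gi [M gM]].
have M1 q : S2 q -> `|complex.Re (g q)| <= M by move=> /gM[].
have M2 q : S2 q -> `|complex.Im (g q)| <= M by move=> /gM[].
split.
- have := integrableB mS2 (integrableM fr gr M1) (integrableM fi gi M2).
  by apply: eq_integrable => // q _ /=; rewrite RecM.
- have := integrableD mS2 (integrableM fr gi M2) (integrableM fi gr M1).
  by apply: eq_integrable => // q _ /=; rewrite ImcM.
Qed.

Lemma integrableCMl f g : boundedC f -> integrableC g ->
  integrableC (fun q => f q * g q).
Proof.
by move=> bf ig; apply: eq_integrableC (integrableCM ig bf) => q _; exact: mulrC.
Qed.

Lemma integrableCZ c f : integrableC f -> integrableC (fun q => c * f q).
Proof. by apply: integrableCMl; exact: boundedC_cst. Qed.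

Lemma integrableC_sum (I : Type) (r : seq I) (P : pred I) (F : I -> T3 -> R[i]) :
  (forall i, integrableC (F i)) -> integrableC (fun q => \sum_(i <- r | P i) F i q).
Proof.
move=> bF; elim: r => [|i r IH].
  by apply: eq_integrableC (boundedC_integrable (boundedC_cst 0)) => q _; rewrite big_nil.
case Pi: (P i).
  by apply: eq_integrableC (integrableCD (bF i) IH) => q _; rewrite big_cons Pi.
by apply: eq_integrableC IH => q _; rewrite big_cons Pi.
Qed.

Lemma eq_sphere_integral f g : (forall q, S2 q -> f q = g q) ->
  sphere_integral f = sphere_integral g.
Proof.
by move=> fg; rewrite /sphere_integral; congr (_ +i* _);
  apply: eq_Rintegral => q; rewrite inE => /fg ->.
Qed.

Lemma sphere_integralD f g : integrableC f -> integrableC g ->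
  sphere_integral (fun q => f q + g q) = sphere_integral f + sphere_integral g.
Proof.
move=> [fr fi] [gr gi]; rewrite /sphere_integral.
under eq_Rintegral do rewrite RecD.
under [X in _ +i* X]eq_Rintegral do rewrite ImcD.
by rewrite !RintegralD.
Qed.

Lemma sphere_integralZ c f : integrableC f ->
  sphere_integral (fun q => c * f q) = c * sphere_integral f.
Proof.
move=> [fr fi]; case: c => a b; rewrite /sphere_integral.
under eq_Rintegral do rewrite RecM /=.
under [X in _ +i* X]eq_Rintegral do rewrite ImcM /=.
have iZ (k : R) (h : T3 -> R) : sigma.-integrable S2 (EFin \o h) ->
    sigma.-integrable S2 (EFin \o (fun q => k * h q)).
  by move=> ih; have := integrableZl mS2 k ih; apply: eq_integrable => // q _.
rewrite RintegralB//; [|exact: iZ..].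
rewrite RintegralD//; [|exact: iZ..].
by rewrite !RintegralZl.
Qed.

Lemma sphere_integral0 : sphere_integral (fun=> 0 : R[i]) = 0.
Proof.
rewrite (eq_sphere_integral (g := fun q => 0 * 0)) => [|q _]; last by rewrite mul0r.
by rewrite sphere_integralZ ?mul0r//; apply/boundedC_integrable/boundedC_cst.
Qed.

Lemma sphere_integral_sum (I : Type) (r : seq I) (P : pred I) (F : I -> T3 -> R[i]) :
  (forall i, integrableC (F i)) ->
  sphere_integral (fun q => \sum_(i <- r | P i) F i q) =
  \sum_(i <- r | P i) sphere_integral (F i).
Proof.
move=> iF; elim: r => [|i r IH].
  rewrite big_nil -[RHS]sphere_integral0; apply: eq_sphere_integral => q _.
  by rewrite big_nil.
rewrite big_cons; case Pi: (P i); last first.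
  by rewrite -IH; apply: eq_sphere_integral => q _; rewrite big_cons Pi.
rewrite -IH -sphere_integralD//; last exact: integrableC_sum.
by apply: eq_sphere_integral => q _; rewrite big_cons Pi.
Qed.

(** Equivalent to the usual L^1 norm; splitting the parts makes it bound real and
    imaginary parts separately. *)
Definition normL1 f : R := \int[sigma]_(q in S2) `|complex.Re (f q)| +
                           \int[sigma]_(q in S2) `|complex.Im (f q)|.

Lemma normc_sphere_integral (k : T3 -> R) (e : R) eta :
  integrableC eta -> measurable_fun S2 k -> (forall q, S2 q -> `|k q| <= e) ->
  Normc.normc (sphere_integral (fun q => (k q)%:C * eta q)) <= e * normL1 eta.
Proof.
move=> [er ei] mk ke.
have key (h : T3 -> R) : sigma.-integrable S2 (EFin \o h) ->
    `|\int[sigma]_(q in S2) (k q * h q)| <= e * \int[sigma]_(q in S2) `|h q|.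
  move=> ih; have ikh : sigma.-integrable S2 (EFin \o (fun q => k q * h q)).
    by have := integrableM ih mk ke; apply: eq_integrable => // q _; rewrite /= mulrC.
  apply: le_trans (le_normr_Rintegral mS2 ikh) _.
  have ih' := integrable_norm ih.
  rewrite -RintegralZl//; apply: le_Rintegral => //.
  - exact: integrable_norm.
  - by have := integrableZl mS2 e ih'; apply: eq_integrable => // q _.
  - by move=> q Sq /=; rewrite normrM ler_wpM2r// ke.
rewrite /normL1 mulrDr (le_trans (normc_le_ReIm _))// /sphere_integral /=.
apply: lerD; (apply: le_trans (key _ _) => //);
  rewrite le_eqVlt; apply/orP; left; apply/eqP; congr `| _ |;
  by apply: eq_Rintegral => q _; rewrite ?RecM ?ImcM /= mul0r ?subr0 ?addr0.
Qed.

End SphereIntegralC.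

(** * Trigonometric integrals *)

Section TrigIntegrals.
Context {R : realType}.
Local Notation leb := (@lebesgue_measure R).

Lemma Rintegral_derive (F f : R -> R) (a b : R) : a < b ->
  (forall x : R, is_derive x (1 : R) F (f x)) -> continuous f ->
  \int[leb]_(x in `[a, b]) f x = F b - F a.
Proof.
move=> ab dF cf.
have cF x : {for x, continuous F}.
  by apply: differentiable_continuous; apply/derivable1_diffP; apply: ex_derive.
rewrite /Rintegral (@continuous_FTC2 _ f F)//.
- exact: continuous_subspaceT.
- split.
  + by move=> x _; apply: ex_derive.
  + exact/cvg_at_right_filter/cF.
  + exact/cvg_at_left_filter/cF.
- by move=> x _; rewrite derive1E; apply: derive_val.
Qed.

Lemma continuous_scale (k : R) (f : R -> R) :
  continuous f -> continuous (fun x => k * f x).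
Proof. by move=> cf x; apply: cvgM; [exact: cvg_cst|exact: cf]. Qed.

Lemma continuous_sub (f g : R -> R) :
  continuous f -> continuous g -> continuous (fun x => f x - g x).
Proof. by move=> cf cg x; apply: cvgB; [exact: cf|exact: cg]. Qed.

Lemma continuous_sincos (n m : nat) :
  continuous (fun x : R => sin x ^+ n * cos x ^+ m).
Proof.
move=> x; apply: (@continuousM _ _ (fun x => sin x ^+ n) (fun x => cos x ^+ m)).
  by apply: (@continuous_comp _ _ _ (@sin R) (fun y => y ^+ n)); [exact: continuous_sin|exact: exprn_continuous].
by apply: (@continuous_comp _ _ _ (@cos R) (fun y => y ^+ m)); [exact: continuous_cos|exact: exprn_continuous].
Qed.

Definition sincos (n m : nat) : R := \int[leb]_(x in `[0, pi]) (sin x ^+ n * cos x ^+ m).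

Lemma integrable_continuous (f : R -> R) (a b : R) : continuous f ->
  leb.-integrable `[a, b] (EFin \o f).
Proof.
move=> cf; apply: continuous_compact_integrable; first exact: segment_compact.
exact: continuous_subspaceT.
Qed.

(** The derivative of sin^(n+2) cos^(m+1) has integral 0 over [0, pi]. *)
Lemma sincosSS (n m : nat) :
  m.+1%:R * sincos n.+3 m = n.+2%:R * sincos n.+1 m.+2.
Proof.
apply/eqP; rewrite eq_sym -subr_eq0; apply/eqP.
pose f := fun x : R => n.+2%:R * (sin x ^+ n.+1 * cos x ^+ m.+2) -
                       m.+1%:R * (sin x ^+ n.+3 * cos x ^+ m).
pose F := fun x : R => sin x ^+ n.+2 * cos x ^+ m.+1.
have cf : continuous f.
  by apply: continuous_sub; apply: continuous_scale; exact: continuous_sincos.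
have FE : F = (@sin R ^+ n.+2 * @cos R ^+ m.+1).
  by apply/funext => x; rewrite /F fctE !exprfctE.
have dF (x : R) : is_derive x (1 : R) F (f x).
  rewrite FE; apply: is_derive_eq; rewrite /f /GRing.scale /= !exprfctE.
  rewrite -[_ *+ n.+2]mulr_natl -[_ *+ m.+1]mulr_natl !exprS /=; ring.
have := Rintegral_derive (pi_gt0 R) dF cf.
rewrite /F sinpi sin0 !expr0n !mul0r subrr => <-.
have i1 k l : leb.-integrable `[0, pi] (EFin \o (fun x : R => sin x ^+ k * cos x ^+ l)).
  exact/integrable_continuous/continuous_sincos.
rewrite /f RintegralB//; [|by apply/integrable_continuous/continuous_scale;
  exact: continuous_sincos..].
rewrite !RintegralZl//; exact: i1.
Qed.

Lemma sincos1 (m : nat) : m.+1%:R * sincos 1 m = 1 - (-1) ^+ m.+1.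
Proof.
have dF (x : R) : is_derive x (1 : R) (fun x => - cos x ^+ m.+1)
    (m.+1%:R * (sin x ^+ 1 * cos x ^+ m)).
  have -> : (fun x : R => - cos x ^+ m.+1) = - (@cos R ^+ m.+1).
    by apply/funext => y; rewrite fctE exprfctE.
  apply: is_derive_eq; rewrite -[_ *+ m.+1]mulr_natl /GRing.scale /=; ring.
rewrite /sincos -RintegralZl//; last exact/integrable_continuous/continuous_sincos.
rewrite (Rintegral_derive (pi_gt0 R) dF).
  by rewrite cospi cos0 expr1n opprK addrC.
by apply: continuous_scale; exact: continuous_sincos.
Qed.

Lemma expi_nat (n : nat) (x : R) : expi (n%:R * x) = expi x ^+ n.
Proof.
elim: n => [|n IH]; first by rewrite mul0r /expi cos0 sin0.
rewrite exprS -IH -natr1 mulrDl mul1r addrC /expi cosD sinD.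
by apply/eqP; rewrite eq_complex /= eqxx/= addrC.
Qed.

Lemma int_cos_nat (n : nat) : (0 < n)%N ->
  \int[leb]_(x in `[0, 2 * pi]) cos (n%:R * x) = 0 /\
  \int[leb]_(x in `[0, 2 * pi]) sin (n%:R * x) = 0.
Proof.
move=> n0; have n0' : (n%:R : R) != 0 by rewrite pnatr_eq0 -lt0n.
have twopi : 0 < 2 * pi :> R by rewrite mulr_gt0// pi_gt0.
have cn : continuous (fun x : R => n%:R * x).
  by apply: continuous_scale => x; exact: cvg_id.
have per : n%:R * (2 * pi) = 0 + pi *+ 2 *+ n :> R.
  by rewrite add0r -[RHS]mulr_natl -[pi *+ 2]mulr_natl.
split.
- have dF (x : R) : is_derive x (1 : R) (fun x => n%:R^-1 * sin (n%:R * x)) (cos (n%:R * x)).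
    by apply: is_derive_eq; rewrite /GRing.scale /= mulr1 mulrCA mulVf ?mulr1.
  rewrite (Rintegral_derive twopi dF).
    by rewrite per (periodicn (@sinD2pi R)) mulr0 subrr.
  by move=> x; apply: (@continuous_comp _ _ _ _ (@cos R)); [exact: cn|exact: continuous_cos].
- have dF (x : R) : is_derive x (1 : R) (fun x => - n%:R^-1 * cos (n%:R * x)) (sin (n%:R * x)).
    apply: is_derive_eq; rewrite /GRing.scale /=.
    by field.
  rewrite (Rintegral_derive twopi dF).
    by rewrite per (periodicn (@cosD2pi R)) mulr0 subrr.
  by move=> x; apply: (@continuous_comp _ _ _ _ (@sin R)); [exact: cn|exact: continuous_sin].
Qed.

End TrigIntegrals.

(** * Monomials in x + i y, x - i y and z *)

Section Coordinates.
Context {R : realType}.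
Local Notation T3 := (R * R * R)%type.
Local Notation leb := (@lebesgue_measure R).

Definition uc (q : T3) : R[i] := q.1.1 +i* q.1.2.
Definition ubar (q : T3) : R[i] := q.1.1 -i* q.1.2.
Definition zc (q : T3) : R[i] := (q.2)%:C.

Lemma ubarE q : ubar q = ((uc q)^*)%C. Proof. by []. Qed.

Lemma sphere_eq q : S2 q -> uc q * ubar q + zc q ^+ 2 = 1.
Proof.
rewrite /S2 /dot3 /= => h; apply/eqP; rewrite eq_complex /= -h.
by apply/andP; split; apply/eqP; ring.
Qed.

Lemma S2_le1 (q : T3) : S2 q -> [/\ `|q.1.1| <= 1, `|q.1.2| <= 1 & `|q.2| <= 1].
Proof.
rewrite /S2 /dot3 /= => h.
have sq (x : R) : x * x <= 1 -> `|x| <= 1.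
  by move=> x1; rewrite -(@expr_le1 _ 2)// real_normK ?num_real// expr2.
have := sqr_ge0 q.1.1; have := sqr_ge0 q.1.2; have := sqr_ge0 q.2.
by rewrite !expr2 => ? ? ?; split; apply: sq; lra.
Qed.

Let m1 : measurable_fun S2 (fun q : T3 => q.1.1).
Proof. by apply: measurable_funTS; apply: (measurableT_comp measurable_fst). Qed.
Let m2 : measurable_fun S2 (fun q : T3 => q.1.2).
Proof. by apply: measurable_funTS; apply: (measurableT_comp measurable_snd). Qed.
Let m3 : measurable_fun S2 (fun q : T3 => q.2).
Proof. by apply: measurable_funTS; exact: measurable_snd. Qed.

Lemma boundedC_uc : boundedC uc.
Proof. by split=> //; exists 1 => q /S2_le1[]. Qed.

Lemma boundedC_ubar : boundedC ubar.
Proof.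
split=> //=; first exact: measurableT_comp m2.
by exists 1 => q /S2_le1[? ? ?]; rewrite normrN.
Qed.

Lemma boundedC_zc : boundedC zc.
Proof. by split=> //=; exists 1 => q /S2_le1[? ? ?]; rewrite normr0. Qed.

Lemma uc_sphere a : uc (sphere_pt a) = (sin a.2)%:C * expi a.1.
Proof. by apply/eqP; rewrite eq_complex /= !mul0r subr0 addr0 !eqxx. Qed.

Lemma expiV (x : R) : expi x * (expi x)^*%C = 1.
Proof.
apply/eqP; rewrite eq_complex /= -(cos2Dsin2 x).
by apply/andP; split; apply/eqP; ring.
Qed.

Lemma ubar_sphere a : ubar (sphere_pt a) = (sin a.2)%:C * (expi a.1)^*%C.
Proof.
by apply/eqP; rewrite eq_complex /= !mul0r subr0 addr0 mulrN !eqxx.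
Qed.

(** e^{i (a - b) x}, the dependence of u^a ubar^b on the azimuth x. *)
Definition expi2 (a b : nat) (x : R) : R[i] := expi x ^+ a * (expi x)^*%C ^+ b.

Lemma expi2E a b x : expi2 a b x =
  if (b <= a)%N then expi ((a - b)%:R * x) else (expi ((b - a)%:R * x))^*%C.
Proof.
rewrite /expi2; case: leqP => ab.
  by rewrite -{1}(subnK ab) exprD -mulrA -exprMn expiV expr1n mulr1 expi_nat.
rewrite -{1}(subnK (ltnW ab)) exprD mulrCA -exprMn expiV expr1n mulr1.
by rewrite expi_nat rmorphXn.
Qed.

(** On the sphere u = sin theta e^{i phi}: the integral over phi vanishes unless u
    and its conjugate occur equally often. *)
Lemma sphere_integral_monomial (a b c : nat) :
  sphere_integral (fun q => uc q ^+ a * ubar q ^+ b * zc q ^+ c) =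
  if a == b then (2 * pi * @sincos R (2 * a).+1 c)%:C else 0.
Proof.
set f := fun q : T3 => _.
have bf : boundedC f.
  apply: boundedCM; last exact/boundedCX/boundedC_zc.
  by apply: boundedCM; apply: boundedCX; [exact: boundedC_uc|exact: boundedC_ubar].
have [ir ii] := boundedC_integrable bf.
have fE (x : R * R) : f (sphere_pt x) =
    expi2 a b x.1 * (sin x.2 ^+ (a + b) * cos x.2 ^+ c)%:C.
  rewrite /f uc_sphere ubar_sphere /expi2 /zc /= !exprMn.
  rewrite rmorphM /= exprD rmorphM /= !rmorphXn /=; ring.
(* the frequency |a - b|; the sign of a - b only matters in the imaginary part *)
pose n := if (b <= a)%N then (a - b)%N else (b - a)%N.
have ReE x : complex.Re (expi2 a b x) = cos (n%:R * x).
  by rewrite expi2E /n; case: leqP.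
have ImE x : complex.Im (expi2 a b x) = (if (b <= a)%N then 1 else -1) * sin (n%:R * x).
  by rewrite expi2E /n; case: leqP; rewrite /= ?mul1r ?mulN1r.
pose h (x : R) := sin x ^+ (a + b) * cos x ^+ c.
have mh : measurable_fun setT h.
  by apply: continuous_measurable_fun; exact: continuous_sincos.
have h1 x : `|h x| <= 1.
  rewrite normrM !normrX mulr_ile1 ?exprn_ge0// exprn_ile1// ?sin_max ?cos_max//.
have mn : measurable_fun setT (fun x : R => n%:R * x) by exact: measurable_funM.
rewrite /sphere_integral.
rewrite (@Rintegral_sphere_prod _ _ (fun x => cos (n%:R * x)) h 1)//; last 3 first.
- by apply: measurableT_comp mn; exact: measurable_cos.
- by move=> x; exact: cos_max.
- by move=> x; rewrite fE RecM /= mulr0 subr0 ReE.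
rewrite (@Rintegral_sphere_prod _ _ (fun x => (if (b <= a)%N then 1 else -1) * sin (n%:R * x)) h 1)//; last 3 first.
- apply: measurable_funM => //.
  by apply: measurableT_comp mn; exact: measurable_sin.
- by move=> x; case: ifP => _; rewrite ?mul1r ?mulN1r ?normrN sin_max.
- by move=> x; rewrite fE ImcM /= mulr0 add0r ImE.
have isin : leb.-integrable `[0, 2 * pi] (EFin \o (fun x : R => sin (n%:R * x))).
  apply: integrable_continuous => x; apply: (@continuous_comp _ _ _ (fun y : R => n%:R * y) (@sin R)); last exact: continuous_sin.
  by apply: continuous_scale => ?; exact: cvg_id.
rewrite RintegralZl//.
case: (eqVneq a b) => ab.
  have n0 : n = 0%N by rewrite /n ab leqnn subnn.
  rewrite n0; under eq_Rintegral do rewrite mul0r cos0.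
  rewrite Rintegral_cst//= lebesgue_measure_itv /= lte_fin mulr_gt0 ?pi_gt0//=.
  rewrite oppr0 addr0 mul1r.
  under [X in _ +i* (_ * X * _)]eq_Rintegral do rewrite mul0r sin0.
  rewrite Rintegral_cst// mul0r mulr0 mul0r; congr (_ +i* _); congr (_ * _).
  by apply: eq_Rintegral => x _; rewrite /h ab mul2n -addnn exprS; ring.
have n0 : (0 < n)%N.
  by rewrite /n; move: ab; rewrite neq_ltn; case: (ltngtP b a) => // ba _; rewrite subn_gt0.
by have [-> ->] := @int_cos_nat R n n0; rewrite mulr0 !mul0r.
Qed.

End Coordinates.

(** * Moments of complex linear forms *)

Section Moments.
Context {R : realType}.
Local Notation T3 := (R * R * R)%type.

(** The symmetry under x |-> pi - x, here as a consequence of [sincosSS]. *)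
Lemma sincos_odd (j c : nat) : odd c -> @sincos R (2 * j).+1 c = 0.
Proof.
elim: j c => [|j IH] c oc.
  have /eqP := @sincos1 R c; rewrite -signr_odd /= oc /= expr0 subrr.
  by rewrite mulf_eq0 pnatr_eq0 /= => /eqP.
have /eqP := @sincosSS R (2 * j) c.
rewrite IH /= ?oc// mulr0 mulf_eq0 pnatr_eq0 /= => /eqP.
by rewrite mulnS.
Qed.

(** The product of binomials is the trinomial coefficient
    (2 M)! / (j! j! (2 M - 2 j)!). *)
Lemma central_bin_rec (M j : nat) : (j < M)%N ->
  (j.+1 * j.+1 * ('C(2 * M, 2 * j.+1) * 'C(2 * j.+1, j.+1)) =
   (2 * (M - j)) * (2 * (M - j)).-1 * ('C(2 * M, 2 * j) * 'C(2 * j, j)))%N.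
Proof.
move=> jM.
have E i : (i <= M)%N ->
    ('C(2 * M, 2 * i) * 'C(2 * i, i) * (i`! * i`!) * (2 * (M - i))`! = (2 * M)`!)%N.
  move=> iM; have h1 : (2 * i <= 2 * M)%N by rewrite leq_mul2l.
  have h2 : (i <= 2 * i)%N by rewrite mul2n -addnn leq_addr.
  rewrite -(bin_fact h1) -(bin_fact h2) mulnBr.
  have -> : (2 * i - i = i)%N by rewrite mul2n -addnn addnK.
  ring.
have := E _ jM; rewrite -(E j (ltnW jM)).
set A := ('C(_, 2 * j.+1))%N; set B := 'C(2 * j.+1, _).
set A' := 'C(_, 2 * j); set B' := 'C(2 * j, _).
have -> : (M - j = (M - j.+1).+1)%N by rewrite subnSK.
rewrite mulnS !addSn add0n /= !factS.
set f := (j`!)%N; set g := ((2 * (M - j.+1))`!)%N; set k := (2 * (M - j.+1))%N => h.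
have f0 : (0 < f)%N by exact: fact_gt0.
have g0 : (0 < g)%N by exact: fact_gt0.
have fg0 : (0 < f * f * g)%N by rewrite !muln_gt0 f0 g0.
apply/eqP; rewrite -(eqn_pmul2r fg0); apply/eqP.
transitivity (A * B * (j.+1 * f * (j.+1 * f)) * g)%N; first by ring.
rewrite h; ring.
Qed.

(** The left-hand side is the contribution of (u ubar)^j z^(2 M - 2 j) to a moment
    of degree 2 M; the right-hand side is 4 pi / (2 M + 1) times the coefficient of
    a^j b^(M - j) in (4 a + b)^M. As j grows, both change by the same ratio, given
    by [sincosSS] and [central_bin_rec]. *)
Lemma sincos_closed (M j : nat) : (j <= M)%N ->
  ('C(2 * M, 2 * j) * 'C(2 * j, j))%:R * (2 * pi * sincos (2 * j).+1 (2 * (M - j))) =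
  4 * pi / (2 * M).+1%:R * ('C(M, j)%:R * 4 ^+ j) :> R.
Proof.
elim: j => [|j IH] jM.
  rewrite muln0 subn0 !bin0 mul1n mul1r expr0 !mulr1.
  have := @sincos1 R (2 * M); rewrite -signr_odd /= mul2n odd_double /= expr1 opprK.
  move=> h; apply: (@mulfI _ (M.*2.+1)%:R); first by rewrite pnatr_eq0.
  rewrite mulrCA [X in _ = X]mulrCA mulfV ?pnatr_eq0// mulr1.
  by rewrite (_ : _ * sincos _ _ = 1 + 1)//; ring.
have jM' : (j < M)%N := jM.
move: (IH (ltnW jM)) => {}IH.
have c2 : (2 * (M - j) = (2 * (M - j.+1)).+2)%N by rewrite -(subnSK jM) mulnS.
have key := @central_bin_rec M j jM'.
move: IH key; rewrite c2 /=.
set A := ('C(_, _) * _)%N; set A' := ('C(_, 2 * j.+1) * _)%N.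
set c := (2 * (M - j.+1))%N => IH keyN.
have key : j.+1%:R * j.+1%:R * A'%:R = c.+2%:R * c.+1%:R * A%:R :> R.
  by rewrite -!natrM keyN.
have := @sincosSS R (2 * j) c.
rewrite (_ : (2 * j).+3 = (2 * j.+1).+1)%N; last by rewrite mulnS.
move=> rec.
have binrec : j.+1%:R * 'C(M, j.+1)%:R = (M - j)%:R * 'C(M, j)%:R :> R.
  by rewrite -!natrM mul_bin_left.
have Mj : (M - j)%:R * 2 = c.+2%:R :> R by rewrite -natrM mulnC -c2.
have j0 : (j.+1%:R : R) != 0 by rewrite pnatr_eq0.
have c0 : (c.+1%:R : R) != 0 by rewrite pnatr_eq0.
apply: (mulfI c0); apply: (mulfI j0); apply: (mulfI j0).
transitivity (j.+1%:R * j.+1%:R * A'%:R * (2 * pi) * (c.+1%:R * @sincos R (2 * j.+1).+1 c)); first by ring.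
rewrite rec key.
transitivity ((c.+2%:R * c.+1%:R) * (2 * j).+2%:R * (A%:R * (2 * pi * @sincos R (2 * j).+1 c.+2))); first by ring.
rewrite IH.
transitivity (c.+1%:R * 4 * @pi R / (2 * M).+1%:R * (j.+1%:R * ((j.+1%:R * 'C(M, j.+1)%:R) * (4 ^+ j.+1)))); last by ring.
rewrite binrec -Mj (_ : (2 * j).+2 = 2 * j.+1)%N; last by rewrite mulnS.
rewrite natrM exprS; ring.
Qed.

Lemma sum_evens (F : nat -> R[i]) (M : nat) : (forall i, odd i -> F i = 0) ->
  \sum_(i < (2 * M).+1) F i = \sum_(j < M.+1) F (2 * j)%N.
Proof.
move=> F0; elim: M => [|M IH]; first by rewrite !big_ord1.
rewrite mulnS !addSn add0n 2!big_ord_recr /= IH [RHS]big_ord_recr /=.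
rewrite (F0 (2 * M).+1) ?addr0; last by rewrite /= mul2n odd_double.
by rewrite mulnS.
Qed.

(** The linear form w . q for w = (al + be, i (al - be), ga); every w in C^3 is of
    this form, and w . w = 4 al be + ga^2. *)
Definition linform (al be ga : R[i]) (q : T3) : R[i] :=
  al * uc q + be * ubar q + ga * zc q.

Lemma boundedC_linform al be ga : boundedC (linform al be ga).
Proof.
apply: boundedCD; [apply: boundedCD|]; apply: boundedCZ;
  [exact: boundedC_uc|exact: boundedC_ubar|exact: boundedC_zc].
Qed.

Lemma linform_pow al be ga N q : linform al be ga q ^+ N =
  \sum_(i < N.+1) \sum_(j < i.+1)
    ('C(N, i)%:R * 'C(i, j)%:R * al ^+ (i - j) * be ^+ j * ga ^+ (N - i)) *
      (uc q ^+ (i - j) * ubar q ^+ j * zc q ^+ (N - i)).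
Proof.
rewrite /linform addrC exprDn; apply: eq_bigr => i _.
rewrite [X in _ * X *+ _]exprDn -mulr_natl !mulr_sumr; apply: eq_bigr => j _.
rewrite -mulr_natl !exprMn; ring.
Qed.

(** In the trinomial expansion only the terms with as many factors u as ubar and an
    even power of z survive, and by [sincos_closed] they add up to the binomial
    expansion of (w . w)^(N / 2). *)
Lemma sphere_integral_linform_pow al be ga N :
  sphere_integral (fun q => linform al be ga q ^+ N) =
  if odd N then 0
  else (4 * pi / N.+1%:R)%:C * (4 * al * be + ga ^+ 2) ^+ N./2.
Proof.
(* the contribution of the monomials of degree N - i in z *)
pose G i : R[i] := if odd i then 0 else
  'C(N, i)%:R * 'C(i, i./2)%:R * (al * be) ^+ i./2 * ga ^+ (N - i) *
  (2 * pi * sincos i.+1 (N - i))%:C.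
have bm a b c : boundedC (fun q : T3 => uc q ^+ a * ubar q ^+ b * zc q ^+ c).
  apply: boundedCM; last exact/boundedCX/boundedC_zc.
  by apply: boundedCM; apply: boundedCX; [exact: boundedC_uc|exact: boundedC_ubar].
have -> : sphere_integral (fun q => linform al be ga q ^+ N) = \sum_(i < N.+1) G i.
  under eq_sphere_integral do rewrite linform_pow.
  rewrite sphere_integral_sum; last first.
    by move=> i; apply: integrableC_sum => j; exact/integrableCZ/boundedC_integrable.
  apply: eq_bigr => i _.
  rewrite sphere_integral_sum; last first.
    by move=> j; exact/integrableCZ/boundedC_integrable.
  under eq_bigr.
    move=> j _; rewrite sphere_integralZ; last exact: boundedC_integrable.
    rewrite sphere_integral_monomial; over.
  have Eij (j : 'I_i.+1) : (i - j == j :> nat)%N = (i == 2 * j :> nat)%N.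
    by rewrite mul2n -addnn -(eqn_add2r j (i - j)) subnK// -ltnS.
  rewrite /G; case: ifPn => oi.
    rewrite big1// => j _; rewrite Eij; case: eqP => [E|_]; last by rewrite mulr0.
    by have := oi; rewrite (congr1 odd E) mul2n odd_double.
  have hi : (i./2 < i.+1)%N by rewrite ltnS -{2}(odd_double_half i) -addnn; lia.
  have i2 : (i = 2 * i./2 :> nat)%N.
    by rewrite mul2n -[LHS]odd_double_half (negbTE oi).
  rewrite (bigD1 (Ordinal hi)) //= big1 ?addr0 => [|j]; last first.
    rewrite -val_eqE /= => ne; rewrite Eij; case: eqP => [E|_]; last by rewrite mulr0.
    by move: ne; rewrite (congr1 half E) mul2n doubleK eqxx.
  rewrite (Eij (Ordinal hi)) /= -i2 eqxx.
  have -> : (i - i./2 = i./2)%N by rewrite {1}i2 mul2n -addnn addnK.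
  by rewrite -i2 exprMn; ring.
case: ifPn => oN.
  rewrite big1// => i _; rewrite /G; case: ifPn => // oi.
  rewrite -[in i.+1](odd_double_half i) (negbTE oi) add0n -mul2n sincos_odd ?mulr0//.
  by rewrite oddB ?oN ?(negbTE oi)// -ltnS.
have N2 : (N = 2 * N./2)%N by rewrite mul2n -[LHS]odd_double_half (negbTE oN).
have G0 i : odd i -> G i = 0 by move=> oi; rewrite /G oi.
have := sum_evens N./2 G0; rewrite -N2 => ->.
rewrite addrC exprDn mulr_sumr; apply: eq_bigr => j _.
have jN : (j <= N./2)%N by rewrite -ltnS.
rewrite /G mul2n odd_double doubleK -mul2n.
have := sincos_closed jN; rewrite -N2 => /(congr1 (fun x => x%:C)).
rewrite !rmorphM /= !rmorphXn /= !rmorph_nat => h.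
have -> : (N - 2 * j = 2 * (N./2 - j))%N by lia.
rewrite exprM -mulr_natl !exprMn.
transitivity (('C(N, 2 * j)%:R * 'C(2 * j, j)%:R *
    (2 * (pi : R)%:C * (@sincos R (2 * j).+1 (2 * (N./2 - j)))%:C)) *
    (al ^+ j * be ^+ j * (ga ^+ (N./2 - j) * ga ^+ (N./2 - j)))).
  by ring.
by rewrite h; ring.
Qed.

End Moments.

(** * Powers of isotropic linear forms *)

Section Harmonics.
Context {R : realType}.
Local Notation T3 := (R * R * R)%type.
Local Notation C := R[i].

(** Polynomial identities are compared coefficientwise by means of the infinitely
    many points 1, 2, 3, ...; leaving out t = 0 allows the substitution of 1 / t in
    [harm_reflect]. *)
Lemma coef_ext (n : nat) (F G : nat -> C) :
  (forall t, t != 0 -> \sum_(k < n) F k * t ^+ k = \sum_(k < n) G k * t ^+ k) ->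
  forall k, (k < n)%N -> F k = G k.
Proof.
move=> FG k kn; pose p := \poly_(k < n) (F k - G k).
suff p0 : p = 0.
  by have := congr1 (fun q : {poly C} => q`_k) p0;
    rewrite coef_poly kn coef0 => /eqP; rewrite subr_eq0 => /eqP.
apply/eqP/negPn/negP => p0.
pose rs : seq C := [seq i.+1%:R | i <- iota 0 (size p)].
have := @max_poly_roots _ p rs p0; rewrite size_map size_iota ltnn => h.
suff : false by []. apply: h.
  apply/allP => x /mapP[i _ ->]; rewrite rootE horner_poly.
  under eq_bigr do rewrite mulrBl.
  by rewrite sumrB FG ?subrr// pnatr_eq0.
rewrite map_inj_uniq ?iota_uniq// => i j /eqP; by rewrite eqr_nat => /eqP [].
Qed.

(** The coefficient of t^s in the moment of degree m + s of w1 + t w2: as w2 is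
    isotropic, (w1 + t w2) . (w1 + t w2) is affine in t. *)
Lemma sphere_integral_isotropic (a1 b1 c1 a2 b2 c2 : C) (m s : nat) :
  4 * a2 * b2 + c2 ^+ 2 = 0 ->
  'C(m + s, s)%:R *
   sphere_integral (fun q => linform a1 b1 c1 q ^+ m * linform a2 b2 c2 q ^+ s) =
  if odd (m + s) then 0
  else (4 * pi / (m + s).+1%:R)%:C * ('C((m + s)./2, s)%:R *
     (4 * a1 * b1 + c1 ^+ 2) ^+ ((m + s)./2 - s) *
     (4 * a1 * b2 + 4 * a2 * b1 + 2 * c1 * c2) ^+ s).
Proof.
move=> iso; set N := (m + s)%N.
have bl := @boundedC_linform R.
have bi i j : boundedC (fun q : T3 => linform a1 b1 c1 q ^+ i * linform a2 b2 c2 q ^+ j).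
  by apply: boundedCM; apply: boundedCX.
pose F i : C := 'C(N, i)%:R *
  sphere_integral (fun q => linform a1 b1 c1 q ^+ (N - i) * linform a2 b2 c2 q ^+ i).
pose n1 := 4 * a1 * b1 + c1 ^+ 2.
pose B2 := 4 * a1 * b2 + 4 * a2 * b1 + 2 * c1 * c2.
(* the coefficient of t^i in the N-th moment of w1 + t w2 *)
pose G i : C := if odd N then 0 else
  (4 * pi / N.+1%:R)%:C * ('C(N./2, i)%:R * n1 ^+ (N./2 - i) * B2 ^+ i).
suff h : forall t, t != 0 -> \sum_(k < N.+1) F k * t ^+ k = \sum_(k < N.+1) G k * t ^+ k.
  have sN : (s < N.+1)%N by rewrite ltnS leq_addl.
  by have := coef_ext h sN; rewrite /F /G {2}/N addnK.
move=> t _.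
transitivity (sphere_integral (fun q =>
    linform (a1 + t * a2) (b1 + t * b2) (c1 + t * c2) q ^+ N)).
  have E q : linform (a1 + t * a2) (b1 + t * b2) (c1 + t * c2) q ^+ N =
    \sum_(i < N.+1) ('C(N, i)%:R * t ^+ i) *
       (linform a1 b1 c1 q ^+ (N - i) * linform a2 b2 c2 q ^+ i).
    have -> : linform (a1 + t * a2) (b1 + t * b2) (c1 + t * c2) q =
        linform a1 b1 c1 q + t * linform a2 b2 c2 q by rewrite /linform; ring.
    rewrite exprDn; apply: eq_bigr => i _; rewrite -mulr_natl exprMn; ring.
  under eq_sphere_integral do rewrite E.
  rewrite sphere_integral_sum; last by move=> i; exact/integrableCZ/boundedC_integrable.
  apply: eq_bigr => i _; rewrite sphere_integralZ; last exact: boundedC_integrable.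
  by rewrite /F; ring.
rewrite sphere_integral_linform_pow /G; case: (odd N).
  by rewrite big1// => i _; rewrite mul0r.
have -> : 4 * (a1 + t * a2) * (b1 + t * b2) + (c1 + t * c2) ^+ 2 =
    n1 + t * B2 + t ^+ 2 * (4 * a2 * b2 + c2 ^+ 2) by rewrite /n1 /B2; ring.
rewrite iso mulr0 addr0 exprDn mulr_sumr.
rewrite (big_ord_widen N.+1 (fun i => (4 * pi / N.+1%:R)%:C *
  (n1 ^+ (N./2 - i) * (t * B2) ^+ i *+ 'C(N./2, i)))); last by lia.
rewrite big_mkcond; apply: eq_bigr => i _; case: ltnP => iN.
  by rewrite -mulr_natl exprMn; ring.
by rewrite bin_small// !mul0r mulr0 mul0r.
Qed.

(** v(c) . q as a polynomial in c, where
    v(c) = (i (c^2 + 1) / 2, (1 - c^2) / 2, c). *)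
Definition isoP (q : T3) : {poly C} :=
  ('i%R / 2 * uc q)%:P * 'X^2 + (zc q)%:P * 'X + ('i%R / 2 * ubar q)%:P.

(** Powers of isotropic linear forms are harmonic polynomials, and so are their
    coefficients in c; this one turns out to be a multiple of the spherical harmonic
    of degree s and order k - s. *)
Definition harm (s k : nat) (q : T3) : C := (isoP q ^+ s)`_k.

Lemma horner_isoP q c : (isoP q).[c] = linform ('i%R / 2 * c ^+ 2) ('i%R / 2) c q.
Proof. by rewrite /isoP /linform !hornerE /=; ring. Qed.

Lemma size_isoP_exp q s : (size (isoP q ^+ s)%R <= (2 * s).+1)%N.
Proof.
have h : (size (isoP q) <= 3)%N.
  rewrite /isoP; apply: leq_trans (size_polyD _ _) _.
  rewrite geq_max (leq_trans (size_polyC_leq1 _))// andbT.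
  apply: leq_trans (size_polyD _ _) _; rewrite geq_max.
  apply/andP; split; apply: leq_trans (size_polyMleq _ _) _.
    by rewrite size_polyXn -subn1 leq_subLR leq_add2r size_polyC_leq1.
  by rewrite size_polyX -subn1 leq_subLR addnC leq_add2l (leq_trans (size_polyC_leq1 _)).
apply: leq_trans (size_poly_exp_leq _ _) _.
by rewrite ltnS leq_mul2r; lia.
Qed.

Lemma isoP_expE q s c : linform ('i%R / 2 * c ^+ 2) ('i%R / 2) c q ^+ s =
  \sum_(k < (2 * s).+1) harm s k q * c ^+ k.
Proof.
by rewrite -horner_isoP -horner_exp (horner_coef_wide _ (size_isoP_exp q s)).
Qed.

Lemma harmS s k q : harm s.+1 k q =
  'i%R / 2 * uc q * (if (k < 2)%N then 0 else harm s (k - 2) q) +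
  zc q * (if k == 0 then 0 else harm s k.-1 q) + 'i%R / 2 * ubar q * harm s k q.
Proof.
rewrite /harm exprS {1}/isoP; set P := isoP q ^+ s.
rewrite !mulrDl !coefD -(mulrA ('i%R / 2 * uc q)%:P) -(mulrA (zc q)%:P).
by rewrite !coefCM coefXnM coefXM.
Qed.

Lemma boundedC_harm s k : boundedC (harm s k).
Proof.
elim: s k => [|s IH] k.
  by apply: eq_boundedC (boundedC_cst (k == 0)%:R) => q _; rewrite /harm expr0 coef1.
apply: (@eq_boundedC _ _ _ (fun q _ => esym (harmS s k q))).
apply: boundedCD; [apply: boundedCD|].
- apply: boundedCM; first by apply: boundedCZ; exact: boundedC_uc.
  by case: (k < 2)%N; [exact: (boundedC_cst 0)|exact: IH].
- apply: boundedCM; first exact: boundedC_zc.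
  by case: (k == 0%N); [exact: (boundedC_cst 0)|exact: IH].
- by apply: boundedCM; [exact/boundedCZ/boundedC_ubar|exact: IH].
Qed.

Lemma dot3E (p q : T3) : (dot3 p q)%:C = linform (ubar p / 2) (uc p / 2) (zc p) q.
Proof.
have two : (2 : C) != 0 by rewrite pnatr_eq0.
apply: (mulfI two).
transitivity (ubar p * uc q + uc p * ubar q + 2 * zc p * zc q).
  apply/eqP; rewrite eq_complex /dot3 /=.
  by apply/andP; split; apply/eqP; ring.
by rewrite /linform; field.
Qed.

(** v(c) . v(c) = 0. *)
Lemma isotropic_curve (c : C) : 4 * ('i%R / 2 * c ^+ 2) * ('i%R / 2) + c ^+ 2 = 0.
Proof.
have -> : 4 * ('i%R / 2 * c ^+ 2) * ('i%R / 2) = 'i%R ^+ 2 * c ^+ 2 :> C by field.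
by rewrite sqrCi mulN1r addNr.
Qed.

(** [sphere_integral_isotropic] with w1 = p, w2 = v(c): as p . p = 1, its right-hand
    side depends on p only through (v(c) . p)^s. Then compare the coefficients
    of c^k. *)
Lemma funk_hecke_monomial_ex (m s : nat) : exists tau : C, forall p k, S2 p ->
  (k < (2 * s).+1)%N ->
  sphere_integral (fun q => (dot3 p q)%:C ^+ m * harm s k q) = tau * harm s k p.
Proof.
pose N := (m + s)%N.
exists (if odd N then 0 else 'C(N, s)%:R^-1 *
  ((4 * pi / N.+1%:R)%:C * ('C(N./2, s)%:R * 2 ^+ s))).
move=> p k Sp ks; set tau := (if _ then _ else _).
have two : (2 : C) != 0 by rewrite pnatr_eq0.
pose F k := sphere_integral (fun q => (dot3 p q)%:C ^+ m * harm s k q).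
apply: (@coef_ext (2 * s).+1 F (fun k => tau * harm s k p)) => // c _.
have bd : boundedC (fun q => (dot3 p q)%:C ^+ m).
  apply: boundedCX; apply: eq_boundedC (boundedC_linform _ _ _) => q _.
  by rewrite dot3E.
transitivity (sphere_integral (fun q => linform (ubar p / 2) (uc p / 2) (zc p) q ^+ m *
   linform ('i%R / 2 * c ^+ 2) ('i%R / 2) c q ^+ s)).
  under [RHS]eq_sphere_integral do rewrite -dot3E isoP_expE mulr_sumr.
  rewrite sphere_integral_sum; last first.
    move=> i; apply: boundedC_integrable; apply: boundedCM => //.
    by apply: boundedCM; [exact: boundedC_harm|exact: boundedC_cst].
  apply: eq_bigr => i _; rewrite /F mulrC -sphere_integralZ.
    by apply: eq_sphere_integral => q _; ring.
  by apply: boundedC_integrable; apply: boundedCM => //; exact: boundedC_harm.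
have iso := isotropic_curve c.
have C0 : ('C(N, s)%:R : C) != 0 by rewrite pnatr_eq0 -lt0n bin_gt0 leq_addl.
apply: (mulfI C0); rewrite sphere_integral_isotropic//.
under [in RHS]eq_bigr do rewrite -mulrA.
rewrite -mulr_sumr -isoP_expE /tau /N.
case: ifPn => _; first by rewrite mul0r mulr0.
have -> : 4 * (ubar p / 2) * (uc p / 2) + zc p ^+ 2 = 1.
  by rewrite -[RHS](sphere_eq Sp); field.
have -> : 4 * (ubar p / 2) * ('i%R / 2) + 4 * ('i%R / 2 * c ^+ 2) * (uc p / 2) +
   2 * zc p * c = 2 * linform ('i%R / 2 * c ^+ 2) ('i%R / 2) c p.
  by rewrite /linform; field.
rewrite expr1n exprMn -!mulrA mulVKf //; ring.
Qed.

Lemma harm_pole s : harm s s ((0, 0, 1) : T3) = 1.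
Proof.
have u0 : uc ((0, 0, 1) : T3) = 0 by [].
have ub0 : ubar ((0, 0, 1) : T3) = 0.
  by apply/eqP; rewrite eq_complex /= oppr0 !eqxx.
rewrite /harm /isoP u0 ub0 !mulr0 mul0r add0r addr0.
by rewrite /zc /= rmorph1 mul1r coefXn eqxx.
Qed.

Lemma pole_S2 : S2 ((0, 0, 1) : T3).
Proof. by rewrite /S2 /dot3 /= !mul0r !add0r mul1r. Qed.

(** The factor is read off at the north pole, where [harm s s] is 1. *)
Lemma funk_hecke_monomial (m s k : nat) p : S2 p -> (k < (2 * s).+1)%N ->
  sphere_integral (fun q => (dot3 p q)%:C ^+ m * harm s k q) =
  sphere_integral (fun q => (q.2)%:C ^+ m * harm s s q) * harm s k p.
Proof.
move=> Sp ks; have [tau ht] := funk_hecke_monomial_ex m s.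
rewrite ht//; congr (_ * _).
have ss : (s < (2 * s).+1)%N by lia.
have := ht _ _ pole_S2 ss; rewrite harm_pole mulr1 => <-.
by apply: eq_sphere_integral => q _; rewrite /dot3 /= !mul0r !add0r mul1r.
Qed.

Definition gram_cst (s : nat) : C :=
  'C(2 * s, s)%:R^-1 * ((4 * pi / (2 * s).+1%:R)%:C * (-1) ^+ s).

(** Since v(c) . v(d) = - (c - d)^2 / 2, the integral of (v(c) . q)^s (v(d) . q)^s is
    a multiple of (c - d)^(2 s); the entries are its coefficients at c^k d^l. *)
Lemma gram_harm s k l : (k < (2 * s).+1)%N -> (l < (2 * s).+1)%N ->
  sphere_integral (fun q => harm s k q * harm s l q) =
  if (k + l == 2 * s)%N then gram_cst s * ('C(2 * s, k)%:R * (-1) ^+ l) else 0.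
Proof.
move=> ks ls.
pose G k l := sphere_integral (fun q => harm s k q * harm s l q).
pose Lf c := fun q : T3 => linform ('i%R / 2 * c ^+ 2) ('i%R / 2) c q.
have bh := @boundedC_harm.
have bL c : boundedC (fun q => Lf c q ^+ s) by exact/boundedCX/boundedC_linform.
have key c d : sphere_integral (fun q => Lf c q ^+ s * Lf d q ^+ s) =
    gram_cst s * (- d + c) ^+ (2 * s).
  have iso := isotropic_curve.
  have C0 : ('C(s + s, s)%:R : C) != 0 by rewrite pnatr_eq0 -lt0n bin_gt0 leq_addl.
  apply: (mulfI C0); rewrite sphere_integral_isotropic//.
  rewrite addnn odd_double doubleK subnn expr0 binn -mul2n.
  have -> : 4 * ('i%R / 2 * c ^+ 2) * ('i%R / 2) + 4 * ('i%R / 2 * d ^+ 2) * ('i%R / 2) + 2 * c * d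
     = 'i%R ^+ 2 * (c ^+ 2 + d ^+ 2) + 2 * c * d :> C by field.
  rewrite sqrCi.
  have -> : -1 * (c ^+ 2 + d ^+ 2) + 2 * c * d = (-1) * (- d + c) ^+ 2 by ring.
  move: C0; rewrite addnn -mul2n => C0; rewrite exprMn -exprM /gram_cst -!mulrA mulVKf //; ring.
have step c : forall l, (l < (2 * s).+1)%N ->
   sphere_integral (fun q => Lf c q ^+ s * harm s l q) =
   gram_cst s * ('C(2 * s, l)%:R * (-1) ^+ l * c ^+ (2 * s - l)).
  move=> l' ls'.
  apply: (@coef_ext (2 * s).+1
     (fun l => sphere_integral (fun q => Lf c q ^+ s * harm s l q))
     (fun l => gram_cst s * ('C(2 * s, l)%:R * (-1) ^+ l * c ^+ (2 * s - l)))) => // d _.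
  transitivity (sphere_integral (fun q => Lf c q ^+ s * Lf d q ^+ s)).
    under [RHS]eq_sphere_integral do rewrite /Lf (isoP_expE _ _ d) mulr_sumr.
    rewrite sphere_integral_sum; last first.
      move=> i; apply: boundedC_integrable; apply: boundedCM; first exact: bL.
      by apply: boundedCM; [exact: bh|exact: boundedC_cst].
    apply: eq_bigr => i _; rewrite mulrC -sphere_integralZ.
      by apply: eq_sphere_integral => q _; rewrite /Lf; ring.
    by apply: boundedC_integrable; apply: boundedCM; [exact: bL|exact: bh].
  rewrite key addrC exprDn mulr_sumr; apply: eq_bigr => i _.
  by rewrite (exprNn d) -mulr_natl; ring.
rewrite -/(G k l).
have -> : (if (k + l == 2 * s)%N then gram_cst s * ('C(2 * s, k)%:R * (-1) ^+ l) else 0)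
   = (fun k => (k == 2 * s - l)%N%:R * (gram_cst s * ('C(2 * s, l)%:R * (-1) ^+ l))) k.
  have -> : (k + l == 2 * s)%N = (k == 2 * s - l)%N by apply/eqP/eqP; lia.
  case: eqP => [->|_]; last by rewrite mul0r.
  by rewrite mul1r bin_sub//; lia.
apply: (@coef_ext (2 * s).+1 (G^~ l) (fun k => (k == 2 * s - l)%N%:R * (gram_cst s * ('C(2 * s, l)%:R * (-1) ^+ l)))) => // c _.
transitivity (sphere_integral (fun q => Lf c q ^+ s * harm s l q)).
  under [RHS]eq_sphere_integral do rewrite /Lf (isoP_expE _ _ c) mulr_suml.
  rewrite sphere_integral_sum; last first.
    move=> i; apply: boundedC_integrable; apply: boundedCM; last exact: bh.
    by apply: boundedCM; [exact: bh|exact: boundedC_cst].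
  apply: eq_bigr => i _; rewrite /G mulrC -sphere_integralZ.
    by apply: eq_sphere_integral => q _; rewrite /Lf; ring.
  by apply: boundedC_integrable; apply: boundedCM; exact: bh.
rewrite step//.
have h : (2 * s - l < (2 * s).+1)%N by lia.
rewrite (bigD1 (Ordinal h)) //= eqxx mul1r big1 ?addr0; first by ring.
by move=> i; rewrite -val_eqE /= => /negbTE ->; rewrite !mul0r.
Qed.

Lemma gram_cst_neq0 s : gram_cst s != 0.
Proof.
rewrite /gram_cst !mulf_neq0 ?signr_eq0// ?invr_eq0 ?pnatr_eq0 -?lt0n ?bin_gt0 //.
  by lia.
rewrite -[0]/(0%:C) (inj_eq (@complexI R)) mulf_neq0 ?invr_eq0 ?pnatr_eq0//.
by rewrite mulf_neq0 ?pnatr_eq0// gt_eqF// pi_gt0.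
Qed.

End Harmonics.

(** * Rodrigues' formula *)

Section Rodrigues.
Context {R : realType}.
Local Notation T3 := (R * R * R)%type.
Local Notation C := R[i].

Definition rodr (s : nat) : {poly R} := ('X ^+ 2 - 1) ^+ s.

(** Rodrigues' formula; the divided derivative provides the factor 1 / s!. *)
Definition legendre (s : nat) : {poly R} := (2 ^+ s)^-1 *: (rodr s)^`N(s).

Lemma size_rodr s : (size (rodr s) = (2 * s).+1)%N.
Proof.
have h : size ('X ^+ 2 - 1 : {poly R}) = 3%N.
  by rewrite size_polyDl ?size_polyXn// size_polyN size_poly1.
have n0 : ('X ^+ 2 - 1 : {poly R}) != 0 by rewrite -size_poly_gt0 h.
by rewrite /rodr polySpred ?expf_neq0// size_exp h mulnC.
Qed.

(** The Taylor expansion below is taken at a real point with a complex increment. *)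
Let rodrC s : {poly C} := map_poly (real_complex R) (rodr s).

Let rodrCE s x : (rodrC s).[x] = (x ^+ 2 - 1) ^+ s.
Proof.
by rewrite /rodrC /rodr rmorphXn rmorphB /= map_polyXn rmorph1 !hornerE.
Qed.

Let rodrC_taylor s (x h : C) : ((x + h) ^+ 2 - 1) ^+ s =
  \sum_(k < (2 * s).+1) (rodrC s)^`N(k).[x] * h ^+ k.
Proof.
rewrite -rodrCE; apply: nderiv_taylor_wide; first exact: mulrC.
by rewrite size_map_inj_poly ?size_rodr//; exact: complexI.
Qed.

Let rodrC_real s k (x : R) :
  (rodrC s)^`N(k).[x%:C] = ((rodr s)^`N(k).[x])%:C.
Proof. by rewrite /rodrC nderivn_map horner_map. Qed.

(** From u ubar + z^2 = 1 follows 2 i u (v(c) . q) = (z + i u c)^2 - 1. Its s-th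
    power is [rodr s] at z + i u c, expanded at z in powers of c. *)
Lemma harm_rodrigues s k (q : T3) : S2 q -> (k < (2 * s).+1)%N ->
  (2 * ('i%R * uc q)) ^+ s * harm s k q =
  ('i%R * uc q) ^+ k * ((rodr s)^`N(k).[q.2])%:C.
Proof.
move=> Sq ks; rewrite -rodrC_real.
apply: (@coef_ext _ (2 * s).+1 (fun k => (2 * ('i%R * uc q)) ^+ s * harm s k q)
  (fun k => ('i%R * uc q) ^+ k * (rodrC s)^`N(k).[zc q])) => // c _.
under eq_bigr do rewrite -mulrA.
rewrite -mulr_sumr -isoP_expE -exprMn.
transitivity (((zc q + 'i%R * uc q * c) ^+ 2 - 1) ^+ s); last first.
  by rewrite rodrC_taylor; apply: eq_bigr => j _; rewrite [in LHS]exprMn; ring.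
congr (_ ^+ s).
rewrite -[X in _ = _ - X](sphere_eq Sq) /linform.
have -> : 2 * ('i%R * uc q) * ('i%R / 2 * c ^+ 2 * uc q + 'i%R / 2 * ubar q + c * zc q) =
  'i%R ^+ 2 * (uc q ^+ 2 * c ^+ 2 + uc q * ubar q) + 2 * 'i%R * uc q * c * zc q :> C.
  by field.
have -> : (zc q + 'i%R * uc q * c) ^+ 2 =
  zc q ^+ 2 + 2 * 'i%R * uc q * c * zc q + 'i%R ^+ 2 * (uc q ^+ 2 * c ^+ 2) :> C by ring.
by rewrite sqrCi; ring.
Qed.

Lemma sphere_axis (q : T3) : S2 q -> uc q = 0 -> zc q ^+ 2 = 1.
Proof. by move=> /sphere_eq <- ->; rewrite mul0r add0r. Qed.

Lemma harm_axis s k (q : T3) : uc q = 0 ->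
  harm s k q = if k == s then zc q ^+ s else 0.
Proof.
move=> u0; have ub0 : ubar q = 0 by rewrite ubarE u0 rmorph0.
rewrite /harm /isoP u0 ub0 !mulr0 mul0r add0r addr0 exprMn -rmorphXn coefCM coefXn.
by case: eqP => _; rewrite ?mulr1 ?mulr0.
Qed.

(** If x^2 = 1 then (x + t)^2 - 1 = t (2 x + t), and the s-th power of this has
    (2 x)^s as its coefficient at t^s. *)
Lemma rodr_axis s (x : R) : x ^+ 2 = 1 -> (rodr s)^`N(s).[x] = 2 ^+ s * x ^+ s.
Proof.
move=> x1; apply: (@complexI R); rewrite -rodrC_real.
pose P : {poly C} := ((2 * x%:C)%:P + 'X) ^+ s.
have ss : (s < (2 * s).+1)%N by lia.
rewrite (@coef_ext _ (2 * s).+1 (fun k => (rodrC s)^`N(k).[x%:C])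
   (fun k => ('X^s * P)`_k) _ _ ss).
  rewrite coefXnM ltnn subnn -horner_coef0 /P horner_exp !hornerE.
  by rewrite !rmorphM !rmorphXn /= rmorph_nat exprMn.
move=> t _; rewrite -rodrC_taylor.
have szP : (size ('X^s * P)%R <= (2 * s).+1)%N.
  have sP : (size P <= s.+1)%N.
    have h : (size ((2 * x%:C)%:P + 'X : {poly C})%R <= 2)%N.
      rewrite (leq_trans (size_polyD _ _))// geq_max size_polyX andbT.
      by rewrite (leq_trans (size_polyC_leq1 _)).
    apply: leq_trans (size_poly_exp_leq _ _) _; rewrite ltnS.
    by rewrite -[leqRHS]mul1n leq_mul2r; apply/orP; right; lia.
  apply: leq_trans (size_polyMleq _ _) _; rewrite size_polyXn; lia.
rewrite -(horner_coef_wide _ szP) /P hornerM hornerXn horner_exp hornerD hornerC hornerX -exprMn.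
congr (_ ^+ s).
have := congr1 (real_complex R) x1; rewrite rmorphXn rmorph1 /= => x1'.
by rewrite sqrrD x1'; ring.
Qed.

(** Off the axis u = 0, divide [harm_rodrigues] by (2 i u)^s; on the axis both sides
    vanish unless n = 0. *)
Lemma harm_upper s n (q : T3) : S2 q -> (n <= s)%N ->
  harm s (s + n) q =
  (2 ^+ s)^-1 * ('i%R * uc q) ^+ n * ((rodr s)^`N(s + n).[q.2])%:C.
Proof.
move=> Sq ns; have two : (2 : C) != 0 by rewrite pnatr_eq0.
have ks : (s + n < (2 * s).+1)%N by lia.
have [u0|u0] := eqVneq (uc q) 0.
  rewrite harm_axis// u0 mulr0 -[X in _ == X]addn0 eqn_add2l.
  case: n ns ks => [|n] ns ks; last by rewrite expr0n /= mulr0 mul0r.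
  have z1 : q.2 ^+ 2 = 1.
    by apply: (@complexI R); rewrite rmorphXn rmorph1; exact: sphere_axis.
  rewrite eqxx addn0 rodr_axis// expr0 mulr1 rmorphM !rmorphXn /= rmorph_nat.
  by rewrite mulKf// expf_neq0.
have iu0 : 'i%R * uc q != 0 by rewrite mulf_neq0// neq0Ci.
have := harm_rodrigues Sq ks; rewrite exprMn exprD => h.
have /mulfI := expf_neq0 s iu0; apply.
have /mulfI := expf_neq0 s two; apply.
rewrite mulrA h; field.
by rewrite expf_neq0.
Qed.

Definition reflect_y (q : T3) : T3 := (q.1.1, - q.1.2, q.2).

(** c^2 v(1 / c) is the mirror image of v(c), so that the reflection reverses the
    sequence of coefficients of (v(c) . q)^s. *)
Lemma harm_reflect s k (q : T3) : (k < (2 * s).+1)%N ->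
  harm s (2 * s - k) q = harm s k (reflect_y q).
Proof.
move=> ks.
apply: (@coef_ext _ (2 * s).+1 (fun k => harm s (2 * s - k) q)
  (fun k => harm s k (reflect_y q))) => // c c0.
rewrite -isoP_expE.
transitivity (c ^+ (2 * s) * linform ('i%R / 2 * c^-1 ^+ 2) ('i%R / 2) c^-1 q ^+ s).
  rewrite isoP_expE mulr_sumr (reindex_inj rev_ord_inj) /=.
  apply: eq_bigr => i _; rewrite subSS.
  have i2s : (i <= 2 * s)%N by rewrite -ltnS.
  rewrite subKn// mulrCA; congr (_ * _).
  have -> : c ^+ (2 * s) = c ^+ (2 * s - i) * c ^+ i by rewrite -exprD subnK.
  by rewrite exprVn mulfK// expf_neq0.
rewrite exprM -exprMn; congr (_ ^+ s).
have uE : uc (reflect_y q) = ubar q by [].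
have ubE : ubar (reflect_y q) = uc q by rewrite ubarE uE ubarE conjcK.
have zE : zc (reflect_y q) = zc q by [].
by rewrite /linform uE ubE zE; field; rewrite c0.
Qed.

Lemma reflect_y_S2 (q : T3) : S2 q -> S2 (reflect_y q).
Proof. by rewrite /S2 /dot3 /= mulrNN. Qed.

Lemma harm_lower s n (q : T3) : S2 q -> (n <= s)%N ->
  harm s (s - n) q =
  (2 ^+ s)^-1 * ('i%R * ubar q) ^+ n * ((rodr s)^`N(s + n).[q.2])%:C.
Proof.
move=> Sq ns.
have -> : (s - n = 2 * s - (s + n))%N by lia.
rewrite harm_reflect; last by lia.
by rewrite harm_upper//; exact: reflect_y_S2.
Qed.

Lemma harm_legendre s (q : T3) : S2 q -> harm s s q = ((legendre s).[q.2])%:C.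
Proof.
move=> Sq; rewrite -{2}[s]addn0 harm_upper// expr0 mulr1 addn0 /legendre hornerZ.
by rewrite rmorphM fmorphV rmorphXn /= rmorph_nat.
Qed.

End Rodrigues.

(** * Spherical harmonics as coefficients of isotropic powers *)

Section YlmHarm.
Context {R : realType}.
Local Notation T3 := (R * R * R)%type.
Local Notation C := R[i].

Lemma expiD (x y : R) : expi (x + y) = expi x * expi y.
Proof.
by rewrite /expi cosD sinD; apply/eqP; rewrite eq_complex /= eqxx /= addrC.
Qed.

(** k! undoes the divided derivative, s! belongs to Rodrigues' formula, and the powers
    of i come from i u in [harm_rodrigues]. *)
Definition Ylm_cst (s k : nat) : C :=
  (sph_norm s (k%:Z - s%:Z))%:C * (k`!%:R / s`!%:R) * ('i%R ^+ s / 'i%R ^+ k).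

Lemma Ylm_cst_neq0 s k : (k <= 2 * s)%N -> Ylm_cst s k != 0.
Proof.
move=> ks; have i0 : ('i%R : C) != 0 := neq0Ci _.
have f0 n : (n`!%:R : C) != 0 by rewrite pnatr_eq0 -lt0n fact_gt0.
rewrite /Ylm_cst !mulf_neq0 ?invr_eq0 ?expf_neq0//.
rewrite -[0]/(0%:C) (inj_eq (@complexI R)) /sph_norm mulf_neq0//.
  by rewrite expfz_neq0// oppr_eq0 oner_eq0.
rewrite gt_eqF// sqrtr_gt0 mulr_gt0//.
by rewrite divr_gt0 ?mulr_gt0 ?pi_gt0// ltr_wpDl// mulr_ge0.
Qed.

(** With u = sin theta e^{i phi}, this is [harm_rodrigues] divided by (2 i u)^s. At
    the poles, where u = 0, both sides vanish except in order 0. *)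
Lemma Ylm_harm s k (p : T3) : S2 p -> (k <= 2 * s)%N ->
  Ylm s (k%:Z - s%:Z) p = Ylm_cst s k * harm s k p.
Proof.
move=> Sp ks; set n : int := k%:Z - s%:Z.
have kE : `|(s%:Z + n)%R|%N = k by rewrite /n addrC subrK.
have z1 : -1 <= p.2 <= 1 by rewrite -ler_norml; case: (S2_le1 Sp).
set ph := azimuth p; set r := sin (polar p).
have cosz : cos (polar p) = p.2 by rewrite /polar acosK// in_itv.
have uE : uc p = r%:C * expi ph.
  by rewrite -{1}(sphere_pt_angles Sp) uc_sphere.
have r2 : 1 - p.2 ^+ 2 = r ^+ 2 by rewrite /r sin2cos2 cosz.
have r0 : 0 <= r by rewrite /r /polar sin_acos// sqrtr_ge0.
have f0 m : (m`!%:R : C) != 0 by rewrite pnatr_eq0 -lt0n fact_gt0.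
have two : (2 : C) != 0 by rewrite pnatr_eq0.
have i0 : ('i%R : C) != 0 := neq0Ci _.
have ks' : (k < (2 * s).+1)%N by [].
pose D : C := ((rodr s)^`N(k).[p.2])%:C.
have -> : Ylm s n p = (sph_norm s n)%:C * (k`!%:R / s`!%:R) * (2 ^+ s)^-1 *
    (expi (n%:~R * ph) * ((r ^+ 2) `^ (n%:~R / 2))%:C) * D.
  rewrite /Ylm /Ylm_angles /assoc_legendre -/(polar p) cosz kE -/ph r2.
  rewrite nderivn_def hornerMn -[_ *+ k`!]mulr_natl /D -/(rodr s).
  move: (sph_norm s n) (n%:~R / 2) => N e.
  rewrite !rmorphM /= fmorphV !rmorphM /= !rmorph_nat rmorphXn /= rmorph_nat.
  by field; rewrite f0 expf_neq0.
have [rz|rn0] := eqVneq r 0.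
  have u0 : uc p = 0 by rewrite uE rz mul0r.
  rewrite harm_axis// rz expr0n /=.
  case: eqP => [E|ne]; last first.
    rewrite powR0 ?mulr0 ?mul0r// mulf_neq0 ?invr_eq0// intr_eq0 /n subr_eq0.
    by apply/eqP => -[].
  have n0 : n%:~R = 0 :> R by rewrite /n E subrr.
  rewrite n0 !mul0r powRr0.
  have -> : expi 0 = 1 :> C by rewrite /expi cos0 sin0.
  rewrite rmorph1 !mulr1 /D.
  have p1 : p.2 ^+ 2 = 1.
    by move: r2; rewrite rz expr0n /= => /eqP; rewrite subr_eq0 eq_sym => /eqP.
  rewrite /Ylm_cst -/n E /zc; move: (sph_norm s n) => N.
  rewrite rodr_axis// rmorphM !rmorphXn /= rmorph_nat.
  by field; rewrite !expf_neq0// f0.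
have rpos : 0 < r by rewrite lt_neqAle eq_sym rn0.
have powE : ((r ^+ 2) `^ (n%:~R / 2)) * r ^+ s = r ^+ k.
  have -> : r ^+ 2 = r `^ 2 by rewrite powR_mulrn.
  rewrite -powRrM mulrCA mulfV// mulr1 -powR_mulrn// -powRD; last by rewrite rn0 implybT.
  by rewrite /n -powR_mulrn// intrB subrK.
have eE : expi (n%:~R * ph) * expi ph ^+ s = expi ph ^+ k.
  by rewrite -!expi_nat -expiD -mulrDl /n intrB subrK.
have iu0 : 'i%R * uc p != 0.
  rewrite mulf_neq0// uE mulf_neq0//.
    by rewrite -[0]/(0%:C) (inj_eq (@complexI R)).
  apply/eqP => e0; have := expiV ph; rewrite e0 mul0r => /eqP.
  by rewrite eq_sym oner_eq0.
have := harm_rodrigues Sp ks'; rewrite exprMn -/D => h.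
have /mulfI := expf_neq0 s iu0; apply.
have /mulfI := expf_neq0 s two; apply.
have -> : 2 ^+ s * (('i%R * uc p) ^+ s * (Ylm_cst s k * harm s k p)) =
   Ylm_cst s k * (2 ^+ s * ('i%R * uc p) ^+ s * harm s k p) by ring.
rewrite h /Ylm_cst uE !exprMn -!rmorphXn /= -powE -eE rmorphM /=.
by field; rewrite f0 natrXE natrX !expf_neq0.
Qed.

Lemma Ylm_index s (n : int) : - s%:Z <= n <= s%:Z ->
  exists2 k : nat, (k <= 2 * s)%N & n = k%:Z - s%:Z.
Proof.
move=> /andP[n1 n2]; exists `|(n + s%:Z)%R|%N; lia.
Qed.

End YlmHarm.

(** * The Funk-Hecke formula for the Onsager kernel *)

Section SqrtApprox.
Context {R : realType}.

(** The iteration p |-> p + (x - p^2) / 2, which increases to the square root of x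
    on [0, 1]. *)
Fixpoint sqrt_poly (n : nat) : {poly R} :=
  if n is m.+1 then sqrt_poly m + 2^-1 *: ('X - sqrt_poly m ^+ 2) else 0.

(** One step turns the error e = sqrt x - p into e (1 - (sqrt x + p) / 2), which is
    at most e (1 - e / 2); this preserves N e <= 2 as N grows by one. *)
Lemma sqrt_poly_approx (n : nat) (x : R) : 0 <= x <= 1 ->
  0 <= (sqrt_poly n).[x] <= Num.sqrt x /\
  n.+1%:R * (Num.sqrt x - (sqrt_poly n).[x]) <= 2.
Proof.
move=> /andP[x0 x1]; set y := Num.sqrt x.
have y0 : 0 <= y by exact: sqrtr_ge0.
have y2 : y * y = x by rewrite -expr2 sqr_sqrtr.
have y1 : y <= 1 by rewrite -sqrtr1 ler_wsqrtr.
elim: n => [|n [/andP[p0 py] IH]]; first by rewrite /= horner0 subr0 mul1r lexx y0; split=> //; lra.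
rewrite /= !hornerE; set p := (sqrt_poly n).[x] in p0 py IH *.
rewrite -y2.
have -> : y - (p + 2^-1 * (y * y - p ^+ 2)) = (y - p) * (1 - (y + p) / 2) by field.
split.
  apply/andP; split; nra.
have N1 : 1 <= n.+1%:R :> R by rewrite ler1n.
rewrite -natr1; move: (n.+1%:R) N1 IH => N N1 IH.
have [e e0] : exists e, e = y - p by exists (y - p).
rewrite -e0 in IH *; have -> : p = y - e by rewrite e0; ring.
have e1 : 0 <= e <= y by rewrite e0; lra.
have h1 : (N + 1) * e <= 2 + e by lra.
have h2 : 1 - (y + (y - e)) / 2 <= 1 - e / 2 by lra.
rewrite mulrA; apply: (@le_trans _ _ ((2 + e) * (1 - e / 2))); last by nra.
apply: ler_pM => //; [nra|lra].
Qed.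

Lemma onsager_approx (e : R) : 0 < e -> exists K : {poly R},
  forall t, `|t| <= 1 -> `|onsager t - K.[t]| <= e.
Proof.
move=> e0.
have [n] := @ltr_add_invr R 0 (e / 2) (divr_gt0 e0 (ltr0Sn R 1)).
rewrite add0r => hn.
exists (sqrt_poly n \Po (1 - 'X^2)) => t t1.
rewrite horner_comp !hornerE /onsager.
have t2 : 0 <= 1 - t ^+ 2 <= 1.
  rewrite subr_ge0 lerBlDr lerDl sqr_ge0 andbT -real_normK ?num_real//.
  by rewrite expr_le1.
have [/andP[_ h1] h2] := sqrt_poly_approx n t2.
rewrite ger0_norm ?subr_ge0//.
have : Num.sqrt (1 - t ^+ 2) - (sqrt_poly n).[1 - t ^+ 2] <= 2 * n.+1%:R^-1.
  by rewrite ler_pdivlMr ?ltr0Sn// mulrC.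
by move=> /le_trans; apply; rewrite mulrC -ler_pdivlMr// ltW.
Qed.

End SqrtApprox.

Section FunkHecke.
Context {R : realType}.
Local Notation T3 := (R * R * R)%type.
Local Notation C := R[i].

Lemma dot3_le1 (p q : T3) : S2 p -> S2 q -> `|dot3 p q| <= 1.
Proof.
rewrite /S2 /dot3 /= => hp hq; rewrite ler_norml.
have := sqr_ge0 (p.1.1 - q.1.1); have := sqr_ge0 (p.1.2 - q.1.2).
have := sqr_ge0 (p.2 - q.2); have := sqr_ge0 (p.1.1 + q.1.1).
have := sqr_ge0 (p.1.2 + q.1.2); have := sqr_ge0 (p.2 + q.2).
by rewrite !expr2 => *; apply/andP; split; lra.
Qed.

Lemma measurable_dot3 (p : T3) : measurable_fun setT (dot3 p).
Proof.
rewrite /dot3; apply: measurable_funD; [apply: measurable_funD|];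
  apply: measurable_funM => //.
- exact: (measurableT_comp measurable_fst).
- exact: (measurableT_comp measurable_snd).
Qed.

Lemma onsager_le1 (t : R) : `|onsager t| <= 1.
Proof.
rewrite /onsager ger0_norm ?sqrtr_ge0// -[leRHS]sqrtr1 ler_wsqrtr//.
by rewrite lerBlDr lerDl sqr_ge0.
Qed.

Lemma measurable_onsager : measurable_fun setT (@onsager R).
Proof.
apply: continuous_measurable_fun => t.
apply: (@continuous_comp _ _ _ (fun t : R => 1 - t ^+ 2) (@Num.sqrt R)).
  apply: cvgB; first exact: cvg_cst.
  exact: exprn_continuous.
exact: sqrt_continuous.
Qed.

Lemma boundedC_real (k : T3 -> R) (M : R) : measurable_fun S2 k ->
  (forall q, S2 q -> `|k q| <= M) -> boundedC (fun q => (k q)%:C).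
Proof.
move=> mk kM; split=> //=.
by exists M => q Sq; rewrite kM// normr0 (le_trans _ (kM q Sq)).
Qed.

Lemma boundedC_poly (K : {poly R}) (k : T3 -> R) :
  boundedC (fun q => (k q)%:C) -> boundedC (fun q => (K.[k q])%:C).
Proof.
move=> bk.
apply: (@eq_boundedC _ (fun q => \sum_(i < size K) (K`_i)%:C * (k q)%:C ^+ i)).
  by move=> q _; rewrite horner_coef rmorph_sum; apply: eq_bigr => i _;
    rewrite rmorphM rmorphXn.
by apply: boundedC_sum => i; apply: boundedCZ; exact: boundedCX.
Qed.

Lemma boundedC_dot3 (p : T3) : S2 p -> boundedC (fun q => (dot3 p q)%:C).
Proof.
move=> Sp; apply: (@boundedC_real _ 1).
  by apply: measurable_funTS; exact: measurable_dot3.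
by move=> q Sq; exact: dot3_le1.
Qed.

Lemma boundedC_onsager (p : T3) : boundedC (fun q => (onsager (dot3 p q))%:C).
Proof.
apply: (@boundedC_real _ 1); last by move=> q _; exact: onsager_le1.
apply: measurable_funTS; apply: measurableT_comp; first exact: measurable_onsager.
exact: measurable_dot3.
Qed.

Lemma dot3_pole (q : T3) : dot3 ((0, 0, 1) : T3) q = q.2.
Proof. by rewrite /dot3 /= !mul0r !add0r mul1r. Qed.

Lemma sphere_integral_poly_kernel (K : {poly R}) (p : T3) (eta : T3 -> C) :
  S2 p -> integrableC eta ->
  sphere_integral (fun q => (K.[dot3 p q])%:C * eta q) =
  \sum_(i < size K) (K`_i)%:C * sphere_integral (fun q => (dot3 p q)%:C ^+ i * eta q).
Proof.
move=> Sp ieta.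
have iM m : integrableC (fun q => (dot3 p q)%:C ^+ m * eta q).
  by apply: integrableCMl => //; exact/boundedCX/boundedC_dot3.
under [RHS]eq_bigr => i _.
  rewrite -sphere_integralZ; last exact: iM.
  over.
rewrite -sphere_integral_sum; last by move=> i; exact/integrableCZ/iM.
apply: eq_sphere_integral => q _; rewrite horner_coef rmorph_sum mulr_suml.
by apply: eq_bigr => i _; rewrite rmorphM rmorphXn mulrA.
Qed.

Lemma funk_hecke_poly (K : {poly R}) (s k : nat) p : S2 p -> (k < (2 * s).+1)%N ->
  sphere_integral (fun q => (K.[dot3 p q])%:C * harm s k q) =
  sphere_integral (fun q => (K.[q.2])%:C * harm s s q) * harm s k p.
Proof.
move=> Sp ks.
have ih l : integrableC (@harm R s l) by exact/boundedC_integrable/boundedC_harm.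
rewrite sphere_integral_poly_kernel//.
have -> : sphere_integral (fun q => (K.[q.2])%:C * harm s s q) =
    sphere_integral (fun q => (K.[dot3 ((0, 0, 1) : T3) q])%:C * harm s s q).
  by under [RHS]eq_sphere_integral do rewrite dot3_pole.
rewrite (sphere_integral_poly_kernel _ (@pole_S2 R))//.
rewrite mulr_suml; apply: eq_bigr => i _.
rewrite -mulrA; congr (_ * _).
apply: etrans (funk_hecke_monomial i Sp ks) _.
have poleE : sphere_integral (fun q => (q.2)%:C ^+ i * harm s s q) =
    sphere_integral (fun q => (dot3 ((0, 0, 1) : T3) q)%:C ^+ i * harm s s q).
  by under [RHS]eq_sphere_integral do rewrite dot3_pole.
exact: (congr1 (fun x => x * harm s k p) poleE).
Qed.

Lemma normc_kernel_diff (K : {poly R}) (e : R) (p : T3) (eta : T3 -> C) :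
  S2 p -> integrableC eta ->
  (forall t, `|t| <= 1 -> `|onsager t - K.[t]| <= e) ->
  Normc.normc (sphere_integral (fun q => (onsager (dot3 p q))%:C * eta q) -
    sphere_integral (fun q => (K.[dot3 p q])%:C * eta q)) <= e * normL1 eta.
Proof.
move=> Sp ieta Ke.
have bK : boundedC (fun q => (K.[dot3 p q])%:C) by exact/boundedC_poly/boundedC_dot3.
have bo := boundedC_onsager p.
have mo : measurable_fun S2 (fun q => onsager (dot3 p q)) by case: bo.
have iM f : boundedC f -> integrableC (fun q => f q * eta q).
  by move=> bf; exact: integrableCMl.
have mK : measurable_fun S2 (fun q => K.[dot3 p q]) by case: bK.
rewrite -mulN1r -sphere_integralZ; last exact: iM.
rewrite -sphere_integralD; [|exact: iM|exact/integrableCZ/iM].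
have -> : sphere_integral (fun q => (onsager (dot3 p q))%:C * eta q +
    -1 * ((K.[dot3 p q])%:C * eta q)) =
   sphere_integral (fun q => (onsager (dot3 p q) - K.[dot3 p q])%:C * eta q).
  by apply: eq_sphere_integral => q _; rewrite rmorphB /=; ring.
apply: normc_sphere_integral => //; first exact: measurable_funB.
by move=> q Sq; apply: Ke; exact: dot3_le1.
Qed.

Lemma normcB_le (x y : C) : Normc.normc (x - y) <= Normc.normc x + Normc.normc y.
Proof. by apply: le_trans (le_normcD _ _) _; rewrite normcN. Qed.

(** Both sides are continuous in the kernel for the uniform norm and agree for
    polynomial kernels. *)
Lemma funk_hecke_onsager (s k : nat) p : S2 p -> (k < (2 * s).+1)%N ->
  interaction (harm s k) p = interaction (harm s s) ((0, 0, 1) : T3) * harm s k p.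
Proof.
move=> Sp ks; apply/eqP; rewrite -subr_eq0; apply/eqP.
apply: (@normc_small_eq0 _ _ (normL1 (@harm R s k) +
  normL1 (@harm R s s) * Normc.normc (harm s k p))) => e e0.
have [K Ke] := onsager_approx e0.
have bi l : integrableC (@harm R s l) by exact/boundedC_integrable/boundedC_harm.
have d1 := normc_kernel_diff Sp (bi k) Ke.
have d2 := normc_kernel_diff (@pole_S2 R) (bi s) Ke.
have fh := funk_hecke_poly K Sp ks.
have fh' : sphere_integral (fun q => (K.[q.2])%:C * harm s s q) =
    sphere_integral (fun q => (K.[dot3 ((0, 0, 1) : T3) q])%:C * harm s s q).
  by under [RHS]eq_sphere_integral do rewrite dot3_pole.
rewrite fh' in fh.
rewrite /interaction.
move: d1 d2 fh; set A := sphere_integral _; set B := sphere_integral _.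
set A' := sphere_integral _; set B' := sphere_integral _ => d1 d2 fh.
have -> : A - A' * harm s k p = (A - B) - (A' - B') * harm s k p by rewrite fh; ring.
apply: le_trans (normcB_le _ _) _; rewrite Normc.normcM mulrDr lerD//.
by rewrite mulrA ler_wpM2r// normc_ge0.
Qed.

(** The hypothesis says that eta is orthogonal to all polynomials in p . q, hence to
    their uniform limits. *)
Lemma interaction_eq0 (eta : T3 -> C) (p : T3) : S2 p -> integrableC eta ->
  (forall m, sphere_integral (fun q => (dot3 p q)%:C ^+ m * eta q) = 0) ->
  interaction eta p = 0.
Proof.
move=> Sp ieta h0; apply: (@normc_small_eq0 _ _ (normL1 eta)) => e e0.
have [K Ke] := onsager_approx e0.
have := normc_kernel_diff Sp ieta Ke.
suff -> : sphere_integral (fun q => (K.[dot3 p q])%:C * eta q) = 0 by rewrite subr0.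
rewrite sphere_integral_poly_kernel//.
by rewrite big1// => i _; rewrite h0 mulr0.
Qed.

End FunkHecke.

(** * Legendre polynomials and the eigenvalue integral *)

Section LegendrePolynomials.
Context {R : realType}.
Implicit Types p : {poly R}.

Lemma derivnS_mulX p n : ('X * p)^`(n.+1) = 'X * p^`(n.+1) + p^`(n) *+ n.+1.
Proof.
elim: n => [|n IH]; first by rewrite derivn1 derivM derivX mul1r addrC mulr1n derivn0.
by rewrite derivnS IH derivD derivM derivX mul1r derivMn -!derivnS [in RHS]mulrS addrA [_ + 'X * _]addrC.
Qed.

(** 2^s s! P_s. *)
Let L s : {poly R} := (rodr s)^`(s).

Lemma deriv_rodr s : (@rodr R s.+1)^`() = (2 * s.+1%:R) *: ('X * rodr s).
Proof.
rewrite /rodr deriv_exp /= derivB derivXn derivC subr0 expr1.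
by rewrite -mul_polyC -mulr_natl polyCM !rmorph_nat -(mulr_natl 'X); ring.
Qed.

(** [deriv_rodr] differentiated s + 1 times. *)
Let LS_deriv s : (L s.+1)^`() = (2 * s.+1%:R) *: ('X * (L s)^`() + s.+1%:R *: L s).
Proof.
rewrite /L -derivnS derivSn deriv_rodr derivnZ derivnS_mulX -derivnS.
by rewrite (scaler_nat s.+1 (rodr s)^`(s)).
Qed.

(** The identity X R_(s+1)' = 2 (s + 1) (R_(s+1) + R_s) for R_s = (X^2 - 1)^s,
    differentiated s + 1 times. *)
Let LS_mulX s : 'X * (L s.+1)^`() - s.+1%:R *: L s.+1 = (2 * s.+1%:R) *: (L s)^`().
Proof.
have h : 'X * (rodr s.+1)^`() = (2 * s.+1%:R) *: (rodr s.+1 + rodr s) :> {poly R}.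
  rewrite deriv_rodr {2}/rodr exprS -/(rodr s) -!mul_polyC; ring.
have h' : 'X * (rodr s.+1)^`(s.+2) + s.+1%:R *: (rodr s.+1)^`(s.+1) =
    (2 * s.+1%:R) *: ((rodr s.+1)^`(s.+1) + (rodr s)^`(s.+1)) :> {poly R}.
  move/(congr1 (fun q : {poly R} => q^`(s.+1))) : h.
  by rewrite derivnS_mulX derivnZ derivnD -!derivSn scaler_nat.
rewrite /L -!derivnS; move: h'.
set A := 'X * _; set B := (rodr s.+1)^`(s.+1); set D := (rodr s)^`(s.+1) => h'.
apply/eqP; rewrite subr_eq; apply/eqP.
apply: (@addIr _ (s.+1%:R *: B)); rewrite h' -!mul_polyC polyCM; ring.
Qed.

Lemma legendreE s : legendre s = (2 ^+ s * s`!%:R)^-1 *: L s.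
Proof.
rewrite /legendre /L nderivn_def.
rewrite (_ : _ *+ s`! = (s`!%:R : R) *: (rodr s)^`N(s)); last by rewrite scaler_nat.
by rewrite scalerA invfM -mulrA mulVf ?mulr1// pnatr_eq0 -lt0n fact_gt0.
Qed.

Let cstS s : (2 ^+ s.+1 * s.+1`!%:R)^-1 * (2 * s.+1%:R) = (2 ^+ s * s`!%:R)^-1 :> R.
Proof.
have a0 : (s.+1%:R : R) != 0 by rewrite pnatr_eq0.
have b0 : (s`!%:R : R) != 0 by rewrite pnatr_eq0 -lt0n fact_gt0.
have c0 : (2 ^+ s : R) != 0 by rewrite expf_neq0// pnatr_eq0.
rewrite factS natrM exprS; move: (s.+1%:R : R) (s`!%:R : R) (2 ^+ s : R) a0 b0 c0.
by move=> a b c a0 b0 c0; field; rewrite a0 b0 c0.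
Qed.

Lemma deriv_legendreS s :
  (legendre s.+1)^`() = 'X * (legendre s)^`() + s.+1%:R *: legendre s :> {poly R}.
Proof.
rewrite !legendreE !derivZ LS_deriv scalerA cstS scalerDr.
by rewrite -scalerAr !scalerA [s.+1%:R * _]mulrC.
Qed.

Lemma legendreS_mulX s :
  'X * (legendre s.+1)^`() - s.+1%:R *: legendre s.+1 = (legendre s)^`() :> {poly R}.
Proof.
rewrite !legendreE !derivZ -scalerAr scalerA [s.+1%:R * _]mulrC -scalerA -scalerBr.
by rewrite LS_mulX scalerA cstS.
Qed.

(** Eliminate P_(s+1)' between the two recurrences. *)
Lemma legendre_ode s :
  ((1 - 'X^2) * (legendre s)^`())^`() = - (s%:R * s.+1%:R) *: legendre s :> {poly R}.
Proof.
have E : (1 - 'X^2) * (legendre s)^`() = s.+1%:R *: ('X * legendre s - legendre s.+1) :> {poly R}.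
  have h := legendreS_mulX s; rewrite deriv_legendreS in h.
  rewrite mulrBl mul1r -{1}h -!mul_polyC; ring.
rewrite E derivZ derivB derivM derivX mul1r deriv_legendreS -!mul_polyC.
by rewrite polyCN polyCM -natr1 polyCD polyC1; ring.
Qed.

End LegendrePolynomials.

Section MuIntegral.
Context {R : realType}.
Local Notation leb := (@lebesgue_measure R).
Local Notation T3 := (R * R * R)%type.
Implicit Types p : {poly R}.

(** The integral of p(t) sqrt (1 - t^2) over [-1, 1], by the substitution
    t = cos x. *)
Definition sin2_functional p : R :=
  \int[leb]_(x in `[0, pi]) (sin x ^+ 2 * p.[cos x]).
Local Notation J := sin2_functional.

Let continuous_J p : continuous (fun x : R => sin x ^+ 2 * p.[cos x]).
Proof.
move=> x; apply: cvgM.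
  by apply: (@continuous_comp _ _ _ (@sin R) (fun y => y ^+ 2)); [exact: continuous_sin|exact: exprn_continuous].
by apply: (@continuous_comp _ _ _ (@cos R) (horner p)); [exact: continuous_cos|exact: continuous_horner].
Qed.

Lemma sin2_functionalD p q : J (p + q) = J p + J q.
Proof.
rewrite /J -RintegralD//; [|exact: integrable_continuous..].
by apply: eq_Rintegral => x _; rewrite hornerD mulrDr.
Qed.

Lemma sin2_functionalZ (k : R) p : J (k *: p) = k * J p.
Proof.
rewrite /J -RintegralZl//; last exact: integrable_continuous.
by apply: eq_Rintegral => x _; rewrite hornerZ mulrCA.
Qed.

Lemma sin2_functionalB p q : J (p - q) = J p - J q.
Proof. by rewrite -scaleN1r sin2_functionalD sin2_functionalZ mulN1r. Qed.

(** The derivative of sin^3 x p(cos x) has integral 0 over [0, pi]. *)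
Lemma sin2_functional_parts p : J ((1 - 'X^2) * p^`()) = 3 * J ('X * p).
Proof.
apply/eqP; rewrite -subr_eq0 -opprB oppr_eq0; apply/eqP.
rewrite -sin2_functionalZ -sin2_functionalB /J.
pose F := fun x : R => sin x ^+ 3 * p.[cos x].
have FE : F = (@sin R ^+ 3 * (horner p \o @cos R)).
  by apply/funext => x; rewrite /F fctE exprfctE.
have dp (x : R) : is_derive (x : R) (1 : R) (horner p) (p^`().[x]).
  apply: DeriveDef; first exact: derivable_horner.
  by rewrite derivE derive1E.
have dF (x : R) : is_derive x (1 : R) F
    (sin x ^+ 2 * (3 *: ('X * p) - (1 - 'X^2) * p^`()).[cos x]).
  rewrite FE; apply: is_derive_eq.
  rewrite /GRing.scale /= !exprfctE -[_ *+ 3]mulr_natl !hornerE /=.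
  rewrite -(sin2cos2 x); ring.
rewrite (Rintegral_derive (pi_gt0 R) dF); last exact: continuous_J.
by rewrite /F sinpi sin0 !expr0n !mul0r subrr.
Qed.

Let Iint s := J (legendre s).

(** Both sides are - J (P_(s+1)'), computed by either recurrence: Legendre's equation
    and [sin2_functional_parts] reduce J (X P_n') to a multiple of J (P_n). *)
Lemma legendre_int_rec (s : nat) :
  (s%:R + 2) * (s%:R + 4) * Iint s.+2 = (s%:R + 1) * (s%:R - 1) * Iint s.
Proof.
have E n : - (n%:R * n.+1%:R) * Iint n = J ('X * (legendre n)^`()).
  rewrite /Iint -sin2_functionalZ -legendre_ode derivM sin2_functionalD sin2_functional_parts.
  have -> : (1 - 'X^2)^`() * (legendre n)^`() = (-2) *: ('X * (legendre n)^`()) :> {poly R}.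
    by rewrite derivB derivC derivXn sub0r expr1 scaleNr scaler_nat mulNr mulrnAl.
  by rewrite sin2_functionalZ; ring.
have h1 : (s%:R + 1) * (s%:R - 1) * Iint s = - J ((legendre s.+1)^`()).
  rewrite deriv_legendreS sin2_functionalD sin2_functionalZ -E -/(Iint s) -natr1; ring.
have h2 : (s%:R + 2) * (s%:R + 4) * Iint s.+2 = - J ((legendre s.+1)^`()).
  rewrite -legendreS_mulX sin2_functionalB sin2_functionalZ -E -/(Iint s.+2).
  by rewrite -natr1 -natr1 -natr1; ring.
by rewrite h1 h2.
Qed.

Lemma legendre0 : @legendre R 0 = 1.
Proof. by rewrite /legendre /rodr !expr0 invr1 scale1r nderivn0. Qed.

Lemma legendre1 : @legendre R 1 = 'X.
Proof.
rewrite /legendre /rodr !expr1 nderivn1 derivB derivXn derivC subr0 expr1.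
rewrite (_ : _ *+ 2 = (2 : R) *: 'X); last by rewrite scaler_nat.
by rewrite scalerA mulVf ?scale1r// pnatr_eq0.
Qed.

Lemma legendre_int0 : Iint 0 = pi / 2.
Proof.
rewrite /Iint legendre0 /J.
have dF (x : R) : is_derive x (1 : R) (fun x => 2^-1 * (x - sin x * cos x))
    (sin x ^+ 2 * (1 : {poly R}).[cos x]).
  apply: is_derive_eq; rewrite /GRing.scale /= hornerE.
  have := cos2Dsin2 x => h.
  have c2 : cos x ^+ 2 = 1 - sin x ^+ 2 by rewrite -h; ring.
  transitivity (2^-1 * (1 + sin x ^+ 2 - cos x ^+ 2)); first by ring.
  by rewrite c2; field.
rewrite (Rintegral_derive (pi_gt0 R) dF); last exact: continuous_J.
by rewrite sinpi sin0 !mul0r !subr0 mulr0 subr0 mulrC.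
Qed.

Lemma legendre_int_odd s : odd s -> Iint s = 0.
Proof.
elim/ltn_ind: s => -[|[|s]] IH //.
  move=> _; rewrite /Iint legendre1.
  have := @sin2_functional_parts 1.
  have -> : (1 : {poly R})^`() = 0 by rewrite -polyC1 derivC.
  rewrite mulr0 mulr1.
  rewrite -[X in J X = _](scale0r 1) sin2_functionalZ mul0r => /eqP.
  by rewrite eq_sym mulf_eq0 pnatr_eq0 /= => /eqP.
rewrite /= negbK => os.
have /eqP := legendre_int_rec s; rewrite (IH s)// mulr0 mulf_eq0 => /orP[|/eqP//].
by rewrite gt_eqF// mulr_gt0// ltr_wpDl.
Qed.

Lemma horner_bound p (x : R) : `|x| <= 1 -> `|p.[x]| <= \sum_(i < size p) `|p`_i|.
Proof.
move=> x1; rewrite horner_coef (le_trans (ler_norm_sum _ _ _))//.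
by apply: ler_sum => i _; rewrite normrM normrX ler_piMr// exprn_ile1.
Qed.

(** At the north pole p . q = cos theta, so that the kernel is sin theta; a second
    sine comes from the surface measure, and 2 pi from the azimuth. *)
Lemma interaction_pole s :
  interaction (harm s s) ((0, 0, 1) : T3) = (2 * pi * Iint s)%:C.
Proof.
have e1 : forall q : T3, S2 q -> (onsager (dot3 ((0, 0, 1) : T3) q))%:C * harm s s q =
    (onsager q.2 * (legendre s).[q.2])%:C.
  by move=> q Sq; rewrite dot3_pole harm_legendre// rmorphM.
rewrite /interaction (eq_sphere_integral e1).
set M : R := \sum_(i < size (@legendre R s)) `|(legendre s)`_i|.
pose h (x : R) := onsager (cos x) * (legendre s).[cos x].
have mleg : measurable_fun setT (horner (@legendre R s)).
  by apply: continuous_measurable_fun; exact: continuous_horner.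
have mon := @measurable_onsager R.
have mh : measurable_fun setT h.
  by apply: measurable_funM; (apply: measurableT_comp; last exact: measurable_cos).
have hM x : `|h x| <= M + 1.
  rewrite /h normrM (@le_trans _ _ (1 * M))//; last by rewrite mul1r lerDl.
  by rewrite ler_pM ?onsager_le1// horner_bound// cos_max.
have M0 : 0 <= M by apply: sumr_ge0.
have intf : (@surface_measure R).-integrable S2
    (EFin \o (fun q : T3 => onsager q.2 * (legendre s).[q.2])).
  apply: (@integrable_sphere _ _ (1 * M)).
    apply: measurable_funTS; apply: measurable_funM;
      by apply: (measurableT_comp _ measurable_snd).
  move=> q /S2_le1[_ _ q1]; rewrite normrM ler_pM ?onsager_le1//.
  exact: horner_bound.
rewrite /sphere_integral /=; congr (_ +i* _); last first.
  by rewrite Rintegral_cst ?mul0r//; exact: measurable_S2.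
rewrite (@Rintegral_sphere_prod _ _ (fun=> 1) h (M + 1))//.
- rewrite Rintegral_cst//= lebesgue_measure_itv /= lte_fin mulr_gt0 ?pi_gt0//=.
  rewrite oppr0 addr0 mul1r; congr (_ * _).
  apply: eq_Rintegral => x; rewrite inE /= in_itv /= => x0.
  have s0 := sin_ge0_pi x0.
  rewrite /h /onsager -sin2cos2 sqrtr_sqr ger0_norm// expr2; ring.
- by move=> x; rewrite normr1 lerDr.
- by move=> a; rewrite mul1r.
Qed.

End MuIntegral.

(** * Euler's integral at integers and half-integers *)

Section EulerGamma.
Context {R : realType}.
Local Notation leb := (@lebesgue_measure R).

(** Compact intervals exhausting the half-line, on which the integrands are
    continuous. The map x |-> x^2 sends E 1 n onto E 2 n. *)
Let E (k n : nat) : set R := `[n.+1%:R^-1 ^+ k, n.+1%:R ^+ k].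

Let E_incr k : nondecreasing_seq (E k).
Proof.
move=> m n mn; apply/subsetPset => x; rewrite /E /= !in_itv /= => /andP[h1 h2].
apply/andP; split.
  apply: le_trans h1; rewrite lerXn2r ?nnegrE ?invr_ge0//.
  by rewrite lef_pV2 ?posrE// ler_nat ltnS.
by apply: le_trans h2 _; rewrite lerXn2r ?nnegrE// ler_nat ltnS.
Qed.

Let E_gt0 k n x : E k n x -> 0 < x.
Proof.
rewrite /E /= in_itv /= => /andP[h _]; apply: lt_le_trans h.
by rewrite exprn_gt0// invr_gt0.
Qed.

Let bigcup_E k : (0 < k)%N -> \bigcup_n E k n = `]0, +oo[%classic.
Proof.
move=> k0; apply/seteqP; split=> [x [n _ /E_gt0]|x]; rewrite /= in_itv /= andbT//.
move=> x0; have [n hn] := @ltr_add_invr R 0 x x0; rewrite add0r in hn.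
have [m hm] : exists m : nat, x < m.+1%:R.
  exists (Num.trunc x); by rewrite truncnS_gt.
exists (maxn m n) => //; rewrite /E /= in_itv /=; set N := maxn m n.
have N1 : 1 <= N.+1%:R :> R by rewrite ler1n.
apply/andP; split.
  apply: (@le_trans _ _ n.+1%:R^-1); last exact: ltW.
  apply: (@le_trans _ _ N.+1%:R^-1).
    by apply: ler_iXnr => //; rewrite invf_le1.
  by rewrite lef_pV2 ?posrE// ler_nat ltnS leq_maxr.
apply: (@le_trans _ _ m.+1%:R); first exact: ltW.
apply: (@le_trans _ _ N.+1%:R); first by rewrite ler_nat ltnS leq_maxl.
exact: ler_eXnr.
Qed.

Let cont_within (f : R -> R) k n : (forall x, 0 < x -> {for x, continuous f}) ->
  {within E k n, continuous f}.
Proof.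
move=> cf; apply: continuous_in_subspaceT => x; rewrite inE => /E_gt0; exact: cf.
Qed.

Let E_integrable (f : R -> R) k n : (forall x, 0 < x -> {for x, continuous f}) ->
  leb.-integrable (E k n) (EFin \o f).
Proof.
move=> cf; apply: continuous_compact_integrable; first exact: segment_compact.
exact: cont_within.
Qed.

Let mE k n : @measurable _ (measurableTypeR R) (E k n).
Proof. by rewrite /E. Qed.

Let E_cvg (f : R -> R) k : (0 < k)%N -> (forall x, 0 < x -> {for x, continuous f}) ->
  (forall x, 0 < x -> 0 <= f x) ->
  (\int[leb]_(x in E k n) f x)%:E @[n --> \oo] -->
  (\int[leb]_(x in `]0%R, +oo[) (f x)%:E)%E.
Proof.
move=> k0 cf f0; rewrite -(bigcup_E k0).
have -> : (fun n => (\int[leb]_(x in E k n) f x)%:E) =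
          (fun n => (\int[leb]_(x in E k n) (f x)%:E)%E).
  apply/funext => n; rewrite /Rintegral fineK//.
  have := @integrable_fin_num _ _ _ leb (E k n) (mE k n) _ (E_integrable k n cf).
  exact.
have mf n : measurable_fun (E k n) (EFin \o f).
  exact: (measurable_int leb (E_integrable k n cf)).
have f0' n x : E k n x -> (0 <= (EFin \o f) x)%E.
  by move=> /E_gt0 x0; rewrite lee_fin f0.
have h mu := @ge0_nondecreasing_set_cvg_integral _ (measurableTypeR R) R (E k) (EFin \o f) mu
  (@E_incr k) (mE k) mf f0'.
exact: h.
Qed.

Definition euler_fun (x t : R) : R := t `^ (x - 1) * expR (- t).

Let dpow (x t : R) : 0 < t -> is_derive (t : R) (1 : R) (fun t => t `^ x) (x * t `^ (x - 1)).
Proof. by move=> t0; have := @is_derive1_powR R x t t0. Qed.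

Let cpow (x t : R) : 0 < t -> {for t, continuous (fun t => t `^ x)}.
Proof.
move=> t0; apply: differentiable_continuous; apply/derivable1_diffP.
by have := dpow x t0 => -[].
Qed.

Let cexpN (t : R) : {for t, continuous (fun t => expR (- t))}.
Proof.
apply: (@continuous_comp _ _ _ (fun t : R => - t) (@expR R)); last exact: continuous_expR.
exact: continuousN.
Qed.

Let ceuler (x t : R) : 0 < t -> {for t, continuous (euler_fun x)}.
Proof. by move=> t0; apply: cvgM; [exact: cpow|exact: cexpN]. Qed.

Let euler_ge0 (x t : R) : 0 <= euler_fun x t.
Proof. by rewrite mulr_ge0 ?powR_ge0 ?expR_ge0. Qed.

(** An identity of extended reals: unlike the real number [Euler_integral x], it
    excludes divergence. *)
Definition has_Gamma (x v : R) :=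
  (\int[leb]_(t in `]0%R, +oo[) (euler_fun x t)%:E = v%:E)%E.

Lemma has_GammaE x v : has_Gamma x v -> Euler_integral x = v.
Proof. by move=> h; rewrite /Euler_integral /Rintegral h. Qed.

Let bdry (x t : R) : R := t `^ x * expR (- t).

(** The derivative of t^x e^(-t) is x t^(x-1) e^(-t) - t^x e^(-t). *)
Let parts (x : R) (n : nat) :
  \int[leb]_(t in E 1 n) euler_fun (x + 1) t =
  bdry x n.+1%:R^-1 - bdry x n.+1%:R + x * \int[leb]_(t in E 1 n) euler_fun x t.
Proof.
(* E 1 0 is a single point, to which the fundamental theorem does not apply *)
have [->|n0] := posnP n.
  rewrite /E !expr1 invr1 set_itv1 !Rintegral_set1 mulr0; ring.
pose f t := x * euler_fun x t - euler_fun (x + 1) t.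
have cxe t : 0 < t -> {for t, continuous (fun t => x * euler_fun x t)}.
  by move=> t0; apply: cvgM; [exact: cvg_cst|exact: ceuler].
have cf t : 0 < t -> {for t, continuous f}.
  by move=> t0; apply: cvgB; [exact: cxe|exact: ceuler].
have dF (t : R) : 0 < t -> is_derive (t : R) (1 : R) (bdry x) (f t).
  move=> t0; have d1 := dpow x t0.
  have -> : bdry x = (fun t => t `^ x) * (fun t => expR (- t)) by [].
  apply: is_derive_eq; rewrite /f /euler_fun addrK /GRing.scale /=; ring.
have EE : E 1 n = `[n.+1%:R^-1, n.+1%:R]%classic by rewrite /E !expr1.
have lt1 : n.+1%:R^-1 < n.+1%:R :> R.
  apply: (@lt_trans _ _ 1); last by rewrite ltr1n.
  by rewrite invf_lt1// ltr1n.
have cb t : 0 < t -> {for t, continuous (bdry x)}.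
  by move=> t0; apply: cvgM; [exact: cpow|exact: cexpN].
have ftc : \int[leb]_(t in E 1 n) f t = bdry x n.+1%:R - bdry x n.+1%:R^-1.
  rewrite EE /Rintegral (@continuous_FTC2 _ f (bdry x))//.
  - by rewrite -EE; exact: cont_within.
  - split.
    + move=> y; rewrite in_itv /= => /andP[h1 h2].
      have y0 : 0 < y by apply: lt_trans h1; rewrite invr_gt0.
      by have [] := dF y y0.
    + by apply/cvg_at_right_filter/cb; rewrite invr_gt0.
    + exact/cvg_at_left_filter/cb.
  - move=> y; rewrite in_itv /= => /andP[h1 h2].
    have y0 : 0 < y by apply: lt_trans h1; rewrite invr_gt0.
    by rewrite derive1E; have [_] := dF y y0.
move: ftc; rewrite /f.
rewrite (RintegralB (mE 1 n) (E_integrable 1 n cxe) (@E_integrable (euler_fun (x + 1)) 1 n (@ceuler (x + 1)))).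
rewrite (RintegralZl _ (mE 1 n) (@E_integrable (euler_fun x) 1 n (@ceuler x))).
by move=> h; rewrite -[bdry x _ - _]opprB -h; ring.
Qed.

Let bdry0 (x : R) : 0 < x -> bdry x n.+1%:R^-1 @[n --> \oo] --> (0 : R).
Proof.
move=> x0; apply: (@squeeze_cvgr _ _ _ _ (fun=> 0) (fun n => n.+1%:R^-1 `^ x)).
- apply: nearW => n; apply/andP; split.
    by rewrite /bdry mulr_ge0 ?powR_ge0 ?expR_ge0.
  apply: ler_piMr; first exact: powR_ge0.
  by rewrite -[leRHS]expR0 ler_expR oppr_le0 invr_ge0.
- exact: cvg_cst.
- have /cvg_at_rightP h := @powR_cvg0 R x x0.
  apply: h; split; last exact: cvg_harmonic.
  by move=> n; rewrite invr_gt0.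
Qed.

(** The exponential dominates the term of degree k + 1 > x of its power series. *)
Let bdryy (x : R) : bdry x n.+1%:R @[n --> \oo] --> (0 : R).
Proof.
have [k xk] : exists k : nat, x <= k%:R.
  by exists (Num.trunc x).+1; rewrite ltW// truncnS_gt.
apply: (@squeeze_cvgr _ _ _ _ (fun=> 0) (fun n => k.+1`!%:R * n.+1%:R^-1)).
- apply: nearW => n; apply/andP; split.
    by rewrite /bdry mulr_ge0 ?powR_ge0 ?expR_ge0.
  set b : R := n.+1%:R.
  have b0 : 0 < b by rewrite /b ltr0n.
  have b1 : 1 <= b by rewrite /b ler1n.
  have f0 : 0 < k.+1`!%:R :> R by rewrite ltr0n fact_gt0.
  have h1 : b `^ x <= b ^+ k.
    by have := ler_powR b1 xk; rewrite (powR_mulrn _ (ltW b0)).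
  have h2 : b ^+ k.+1 / k.+1`!%:R <= expR b.
    by apply: le_trans (expR_ge1Dxn k (ltW b0)); rewrite lerDr.
  rewrite /bdry expRN ler_pdivrMr ?expR_gt0//.
  apply: le_trans h1 _.
  apply: (@le_trans _ _ (k.+1`!%:R / b * (b ^+ k.+1 / k.+1`!%:R))).
    rewrite exprS le_eqVlt; apply/orP; left; apply/eqP; field.
    by rewrite !gt_eqF.
  by rewrite ler_wpM2l// divr_ge0 ?ltW.
- exact: cvg_cst.
- by rewrite -(mulr0 (k.+1`!%:R)); apply: cvgM; [exact: cvg_cst|exact: cvg_harmonic].
Qed.

(** Integration by parts, whose boundary terms tend to 0. *)
Lemma has_GammaS x v : 0 < x -> has_Gamma x v -> has_Gamma (x + 1) (x * v).
Proof.
move=> x0 hv; rewrite /has_Gamma.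
have cA := @E_cvg (euler_fun (x + 1)) 1 isT (@ceuler (x + 1)) (fun t _ => euler_ge0 (x + 1) t).
have cB := @E_cvg (euler_fun x) 1 isT (@ceuler x) (fun t _ => euler_ge0 x t).
rewrite hv in cB.
have cBr : \int[leb]_(t in E 1 n) euler_fun x t @[n --> \oo] --> v.
  by move/fine_cvgP: cB => [].
have cAr : (bdry x n.+1%:R^-1 - bdry x n.+1%:R +
     x * \int[leb]_(t in E 1 n) euler_fun x t) @[n --> \oo] --> x * v.
  rewrite -[x * v]add0r -[X in X + _](subr0 0).
  apply: cvgD; first by apply: cvgB; [exact: bdry0|exact: bdryy].
  by apply: cvgM; [exact: cvg_cst|exact: cBr].
have AE : (fun n => (\int[leb]_(t in E 1 n) euler_fun (x + 1) t)%:E) =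
    (fun n => (bdry x n.+1%:R^-1 - bdry x n.+1%:R +
     x * \int[leb]_(t in E 1 n) euler_fun x t)%:E).
  by apply/funext => n; congr (_%:E); exact: parts.
rewrite AE in cA.
apply: (cvg_unique _ cA) => //.
by apply: cvg_EFin; [exact: nearW|exact: cAr].
Qed.

Lemma has_Gamma1 : has_Gamma 1 1.
Proof.
rewrite /has_Gamma.
under eq_integral do rewrite /euler_fun subrr powRr0 mul1r.
rewrite integral_itv_obnd_cbnd; last first.
  apply/measurable_EFinP; apply: measurable_funTS.
  by apply: continuous_measurable_fun; exact: cexpN.
rewrite (@ge0_continuous_FTC2y _ _ (fun t => - expR (- t)) 0 0).
- by rewrite oppr0 expR0 -EFinB opprK add0r.
- by move=> x _; exact: expR_ge0.
- exact/continuous_subspaceT/cexpN.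
- rewrite -oppr0; apply: cvgN; exact: cvgr_expR.
- by move=> x _.
- by apply/cvg_at_right_filter; apply: cvgN; exact: cexpN.
- move=> x _; rewrite derive1E.
  have d : is_derive x (1 : R) (fun t => - expR (- t)) (expR (- x)).
    by apply: is_derive_eq; rewrite /GRing.scale /=; ring.
  by have [_] := d.
Qed.

(** The substitution t = x^2 gives twice the Gaussian integral over the half-line. *)
Lemma has_Gamma_half : has_Gamma (1 / 2) (Num.sqrt pi).
Proof.
have cA := @E_cvg (euler_fun (1 / 2)) 2 isT (@ceuler (1 / 2))
  (fun t _ => euler_ge0 (1 / 2) t).
pose g (x : R) := 2 * gauss_fun x.
have cg t : 0 < t -> {for t, continuous g}.
  by move=> _; apply: cvgM; [exact: cvg_cst|exact: continuous_gauss_fun].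
have g0 t : 0 < t -> 0 <= g t by move=> _; rewrite mulr_ge0// gauss_fun_ge0.
have cB := @E_cvg g 1 isT cg g0.
have Ig : (\int[leb]_(x in `]0%R, +oo[) (g x)%:E = (Num.sqrt pi)%:E)%E.
  have mgf : measurable_fun (`[0%R, +oo[%classic : set (measurableTypeR R)) (EFin \o @gauss_fun R).
    apply/measurable_EFinP; apply: measurable_funTS; exact: measurable_gauss_fun.
  have := @integral0y_gauss R; rewrite -integral_itv_obnd_cbnd; last first.
    by apply: measurable_funS mgf => //; apply: subset_itvr; rewrite bnd_simp.
  move=> h; rewrite /g; under eq_integral do rewrite EFinM.
  rewrite ge0_integralZl// ?h -?EFinM.
  - by congr (_%:E); field.
  - by apply: measurable_funS mgf => //; apply: subset_itvr; rewrite bnd_simp.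
  - by move=> x _; rewrite lee_fin gauss_fun_ge0.
rewrite Ig in cB; rewrite /has_Gamma.
apply: (cvg_unique _ cA) => //.
suff -> : (fun n => (\int[leb]_(x in E 2 n) euler_fun (1 / 2) x)%:E) =
  (fun n => (\int[leb]_(x in E 1 n) g x)%:E) by [].
apply/funext => n; congr (_%:E); rewrite /Rintegral; congr fine.
have a0 : 0 < n.+1%:R^-1 :> R by rewrite invr_gt0.
have ab : n.+1%:R^-1 <= n.+1%:R :> R.
  by apply: (@le_trans _ _ 1); [rewrite invf_le1 ?ler1n|rewrite ler1n].
have d2 : ((fun x : R => x ^+ 2)^`()%classic : R -> R) = (fun x => 2 * x).
  apply/funext => x; rewrite derive1E.
  have d : is_derive x (1 : R) (fun x : R => x ^+ 2) (2 * x).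
    by apply: is_derive_eq; rewrite /GRing.scale /= -[_ *+ 2]mulr_natl; ring.
  by have [_] := d.
have c2 (x : R) : {for x, continuous (fun x : R => 2 * x)}.
  by apply: cvgM; [exact: cvg_cst|exact: cvg_id].
rewrite /E (@integration_by_substitution_increasing _ (fun x : R => x ^+ 2)
  (euler_fun (1 / 2)) n.+1%:R^-1 n.+1%:R)//.
- rewrite d2 !expr1; apply: eq_integral => x; rewrite inE /= in_itv /= => /andP[h1 _].
  have x0 : 0 < x by apply: lt_le_trans h1.
  congr (_%:E); rewrite /euler_fun /g /gauss_fun /= fctE /=.
  have -> : 1 / 2 - 1 = - (2^-1) :> R by field.
  rewrite powRN powR12_sqrt ?sqr_ge0// sqrtr_sqr gtr0_norm//.
  by field; rewrite gt_eqF.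
- move=> x y; rewrite !in_itv /= => /andP[hx _] /andP[hy _] xy.
  rewrite ltr_pXn2r// nnegrE ltW//; first exact: lt_le_trans hx.
  exact: lt_le_trans hy.
- by rewrite d2 => x _; exact: c2.
- by rewrite d2; apply/cvg_ex; eexists; apply/cvg_at_right_filter; exact: c2.
- by rewrite d2; apply/cvg_ex; eexists; apply/cvg_at_left_filter; exact: c2.
- split.
  + by move=> x _; exact: exprn_derivable.
  + by apply/cvg_at_right_filter; exact: exprn_continuous.
  + by apply/cvg_at_left_filter; exact: exprn_continuous.
- exact: (@cont_within _ 2 n (@ceuler (1 / 2))).
Qed.

End EulerGamma.

(** * The eigenvalues *)

Section Eigenvalues.
Context {R : realType}.
Local Notation I := (fun s => @sin2_functional R (legendre s)).

Lemma Gamma_pos (x : R) : 0 < x -> Gamma x = Euler_integral x.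
Proof. by move=> x0; rewrite /Gamma x0 big_ord0 addr0 divr1. Qed.

(** Gamma (m + 1/2) / Gamma (1/2). *)
Definition half_rising (m : nat) : R := \prod_(k < m) (k%:R + 1 / 2).

Lemma half_risingS m : half_rising m.+1 = (m%:R + 1 / 2) * half_rising m.
Proof. by rewrite /half_rising big_ord_recr /= mulrC. Qed.

Lemma Euler_half m : Euler_integral (m%:R + 1 / 2 : R) = half_rising m * Num.sqrt pi.
Proof.
apply: has_GammaE; elim: m => [|m IH].
  by rewrite add0r /half_rising big_ord0 [X in has_Gamma _ X]mul1r; exact: has_Gamma_half.
by rewrite half_risingS -mulrA -natr1 addrAC; apply: has_GammaS => //.
Qed.

Lemma Euler_nat m : Euler_integral (m%:R + 1 : R) = m`!%:R.
Proof.
apply: has_GammaE; elim: m => [|m IH]; first by rewrite add0r; exact: has_Gamma1.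
by rewrite factS natrM -natr1; apply: has_GammaS => //; rewrite ltr_wpDl.
Qed.

Lemma Gamma_minus_half : Gamma (- (1 / 2) : R) = - 2 * Num.sqrt pi.
Proof.
rewrite /Gamma ltrNr oppr0 ltNge divr_ge0//=.
have fl : Num.floor (- (1 / 2) : R) = -1.
  by apply: floor_def; rewrite addNr; apply/andP; split; lra.
rewrite fl /=.
have -> : - (1 / 2) + 2 = 1%:R + 1 / 2 :> R by field.
by rewrite Euler_half half_risingS /half_rising 2!big_ord_recr !big_ord0 /=; field.
Qed.

(** Along the even degrees both sides obey the recurrence [legendre_int_rec]. The
    induction starts at s = 2, as s = 0 involves the continuation of Gamma
    to -1/2. *)
Lemma mu_O_legendre s : mu_O s = 2 * pi * I s.
Proof.
rewrite /mu_O; case: ifPn => os; first by rewrite legendre_int_odd// mulr0.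
have [m ->] : exists m, s = (2 * m)%N by exists s./2; rewrite mul2n even_halfK.
have E2 : (2 * m)%:R / 2 = m%:R :> R by rewrite natrM; field.
have p0 : 0 <= pi :> R := pi_ge0 R.
have sp : Num.sqrt pi * Num.sqrt pi = pi :> R by rewrite -expr2 sqr_sqrtr.
rewrite E2 (Gamma_pos (x := m%:R + 1 / 2)); last by rewrite ltr_wpDl.
rewrite (Gamma_pos (x := m%:R + 1)); last by rewrite ltr_wpDl.
rewrite (Gamma_pos (x := m%:R + 2)); last by rewrite ltr_wpDl.
have -> : m%:R + 2 = m.+1%:R + 1 :> R by rewrite -natr1; ring.
rewrite Euler_half !Euler_nat.
case: m {os E2} => [|m].
  rewrite sub0r Gamma_minus_half muln0 legendre_int0 /half_rising big_ord0 (_ : 1`! = 1)%N // fact0.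
  transitivity (pi * (Num.sqrt pi * Num.sqrt pi) : R); first by field.
  by rewrite sp; field.
have -> : m.+1%:R - 1 / 2 = m%:R + 1 / 2 :> R by rewrite -natr1; field.
rewrite (Gamma_pos (x := m%:R + 1 / 2)); last by rewrite ltr_wpDl.
rewrite Euler_half.
transitivity (- (pi ^+ 2 * half_rising m.+1 * half_rising m) / (2 * m.+1`!%:R * m.+2`!%:R)).
  have f1 : (m.+1`!%:R : R) != 0 by rewrite pnatr_eq0 -lt0n fact_gt0.
  have f2 : (m.+2`!%:R : R) != 0 by rewrite pnatr_eq0 -lt0n fact_gt0.
  have -> : pi ^+ 2 = pi * (Num.sqrt pi * Num.sqrt pi) :> R by rewrite sp expr2.
  move: f1 f2; move: (m.+1`!%:R : R) (m.+2`!%:R : R) => a b f1 f2.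
  by field; rewrite f1 f2.
elim: m => [|m IH].
  have := @legendre_int_rec R 0; rewrite legendre_int0 => h.
  have -> : I (2 * 1)%N = - pi / 16.
    by move: h; rewrite /= !add0r => h; lra.
  by rewrite half_risingS /half_rising big_ord0 !factS fact0; field.
have := @legendre_int_rec R (2 * m.+1).
have -> : ((2 * m.+1).+2 = 2 * m.+2)%N by rewrite [RHS]mulnS.
have -> : (2 * m.+1)%:R = 2 * m%:R + 2 :> R by rewrite natrM -natr1; ring.
have m0 : 0 <= m%:R :> R by [].
have a0 : (2 * m%:R + 2 + 2) * (2 * m%:R + 2 + 4) != 0 :> R by rewrite gt_eqF//; nra.
move=> h; apply: (mulfI a0).
rewrite [RHS]mulrCA h [RHS]mulrCA -IH.
rewrite (half_risingS m.+1) (half_risingS m) -[m.+1%:R]natr1.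
rewrite (factS m.+2) (factS m.+1).
have f1 : ((m.+1)`!%:R : R) != 0 by rewrite pnatr_eq0 -lt0n fact_gt0.
move: (m.+1)`! f1 => F f1.
rewrite !natrM -[m.+3%:R]natr1 -[m.+2%:R]natr1 -[m.+1%:R]natr1.
move: (F%:R : R) (half_rising m) (m%:R : R) m0 f1 {IH h a0} => a b c c0 f1.
field; rewrite f1 /=.
by rewrite !gt_eqF//; lra.
Qed.

Lemma mu_O_rec s :
  (s%:R + 2) * (s%:R + 4) * mu_O s.+2 = (s%:R + 1) * (s%:R - 1) * mu_O s :> R.
Proof. by rewrite !mu_O_legendre mulrCA legendre_int_rec mulrCA. Qed.

Lemma mu_O_odd s : odd s -> mu_O s = 0 :> R.
Proof. by rewrite /mu_O => ->. Qed.

(** The ratio (s + 1) (s - 1) / ((s + 2) (s + 4)) of consecutive values has absolute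
    value less than 1 and is nonzero for even s. *)
Lemma mu_O_even_step m : mu_O (2 * m) != 0 :> R /\
  `|mu_O (2 * m.+1) : R| < `|mu_O (2 * m)|.
Proof.
have step n : mu_O (2 * n) != 0 :> R -> mu_O (2 * n.+1) != 0 :> R /\
  `|mu_O (2 * n.+1) : R| < `|mu_O (2 * n)|.
  move=> n0; have h := mu_O_rec (2 * n).
  have E : ((2 * n).+2 = 2 * n.+1)%N by rewrite mulnS.
  rewrite E in h; set x : R := (2 * n)%:R in h.
  have x0 : 0 <= x by [].
  have x1 : x - 1 != 0.
    rewrite subr_eq0 /x -[1]/(1%:R) eqr_nat; apply/eqP; lia.
  have a0 : 0 < (x + 2) * (x + 4) by nra.
  split.
    apply/eqP => z; move: h; rewrite z mulr0 => /esym/eqP.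
    by rewrite !mulf_eq0 (negbTE n0) (negbTE x1) !orbF gt_eqF// ltr_wpDl.
  have h' : (x + 2) * (x + 4) * `|mu_O (2 * n.+1) : R| =
      `|(x + 1) * (x - 1)| * `|mu_O (2 * n)|.
    by rewrite -[X in X * _ = _](gtr0_norm a0) -!normrM h.
  rewrite -(ltr_pM2l a0) h' ltr_pM2r ?normr_gt0//.
  by rewrite ltr_norml; apply/andP; split; nra.
have nz : mu_O (2 * m) != 0 :> R.
  elim: m => [|m IH]; last by have [] := step _ IH.
  rewrite mu_O_legendre muln0 legendre_int0 gt_eqF//.
  by rewrite !mulr_gt0 ?pi_gt0// invr_gt0.
by split=> //; have [] := step _ nz.
Qed.

Lemma mu_O_inj s t : mu_O s != 0 :> R -> mu_O s = mu_O t :> R -> s = t.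
Proof.
have even r : mu_O r != 0 :> R -> r = (2 * r./2)%N.
  move=> r0; rewrite mul2n even_halfK//.
  by apply: contraNN r0 => /mu_O_odd ->.
move=> s0 st; have t0 : mu_O t != 0 :> R by rewrite -st.
rewrite (even s s0) (even t t0); congr (2 * _)%N.
have dec (m n : nat) : (m < n)%N -> `|mu_O (2 * n) : R| < `|mu_O (2 * m)|.
  elim: n => [//|n IH]; rewrite ltnS leq_eqVlt => /orP[/eqP ->|/IH h].
    by have [] := mu_O_even_step n.
  by apply: lt_trans h; have [] := mu_O_even_step n.
have E : `|mu_O (2 * s./2) : R| = `|mu_O (2 * t./2)| by rewrite -(even s s0) -(even t t0) st.
by case: (ltngtP s./2 t./2) => // /dec; rewrite E ltxx.
Qed.

End Eigenvalues.

(** * Symmetry of the Onsager operator *)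

Section OnsagerOperator.
Context {R : realType}.
Local Notation sigma := (@surface_measure R).
Local Notation T3 := (R * R * R)%type.
Local Notation C := R[i].
Implicit Types (a b : T3 -> R) (eta f g : T3 -> C).

Let mS2 := @measurable_S2 R.

Definition onsager_op a (p : T3) : R :=
  \int[sigma]_(q in S2) (onsager (dot3 p q) * a q).

Lemma interaction_ReIm eta p : interaction eta p =
  onsager_op (fun q => complex.Re (eta q)) p +i*
  onsager_op (fun q => complex.Im (eta q)) p.
Proof.
rewrite /interaction /sphere_integral; congr (_ +i* _); apply: eq_Rintegral => q _.
  by rewrite RecM /= mul0r subr0.
by rewrite ImcM /= mul0r addr0.
Qed.

Let K (z : T3 * T3) : R := onsager (dot3 z.1 z.2).

Let mK : measurable_fun setT K.
Proof.
apply: measurableT_comp; first exact: measurable_onsager.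
rewrite /dot3; apply: measurable_funD; [apply: measurable_funD|];
  apply: measurable_funM;
  repeat (apply: measurable_fst || apply: measurable_snd || apply: measurableT_comp).
Qed.

Let integrable_S2_restrict a : sigma.-integrable S2 (EFin \o a) ->
  sigma.-integrable setT (EFin \o (a \_ S2)).
Proof.
by move=> ia; rewrite -restrict_EFin; apply/integrable_restrict => //; rewrite setTI.
Qed.

Let F a b (z : T3 * T3) : \bar R := (K z * (a \_ S2) z.2 * (b \_ S2) z.1)%:E.

Let onsager_opE a p : onsager_op a p = \int[sigma]_q (K (p, q) * (a \_ S2) q).
Proof.
rewrite /onsager_op Rintegral_mkcond; apply: eq_Rintegral => q _.
by rewrite /K /= !patchE; case: ifP => //; rewrite mulr0.
Qed.

(** The kernel is at most 1 and b is bounded, so the double integral of the absolute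
    value is at most a multiple of the L^1 norm of a. *)
Let integrableF a b (M : R) : sigma.-integrable S2 (EFin \o a) ->
  measurable_fun S2 b -> (forall p, S2 p -> `|b p| <= M) ->
  (sigma \x sigma)%E.-integrable setT (F a b).
Proof.
move=> ia mb bM.
have iA := integrable_S2_restrict ia.
have mA : measurable_fun setT (a \_ S2) by apply/measurable_EFinP; exact: measurable_int iA.
have mB : measurable_fun setT (b \_ S2) by apply/(measurable_restrictT _ mS2).
have BM p : `|(b \_ S2) p| <= `|M|.
  rewrite patchE; case: ifPn => [|_]; last by rewrite normr0.
  by rewrite inE => /bM h; rewrite (le_trans h)// ler_norm.
have mF : measurable_fun setT (F a b).
  apply/measurable_EFinP; apply: measurable_funM; last exact: measurableT_comp.
  by apply: measurable_funM; [exact: mK|exact: measurableT_comp].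
apply/integrable12ltyP => //.
pose A := (\int[sigma]_q `|((a \_ S2) q)%:E|)%E.
have A_lty : (A < +oo)%E by case/integrableP : iA.
have A0 : (0 <= A)%E by exact: integral_ge0.
have le1 p : (\int[sigma]_q `|F a b (p, q)| <= `|M|%:E * A)%E.
  rewrite -ge0_integralZl//; last first.
    by apply/measurable_EFinP; apply: measurableT_comp.
  apply: ge0_le_integral => //.
  - apply: measurableT_comp => //; exact: measurable_fun_pair2 mF.
  - apply/measurable_EFinP; apply: measurable_funM => //; exact: measurableT_comp.
  - move=> q _; rewrite /F /= lee_fin !normrM mulrC ler_pM ?mulr_ge0//.
    by rewrite ler_piMl// onsager_le1.
apply: (@le_lt_trans _ _ (\int[sigma]_p (`|M|%:E * A))%E).
  apply: ge0_le_integral => //.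
  - by move=> p _; exact: integral_ge0.
  - apply: (measurable_fun_fubini_tonelli_F (abse \o F a b)) => //=; exact: measurableT_comp.
have AE : A = (fine A)%:E by rewrite fineK// ge0_fin_numE.
rewrite AE -EFinM integral_cst//.
by rewrite lte_mul_pinfty ?lee_fin ?mulr_ge0 ?fine_ge0//; exact: surface_measure_finite.
Qed.

Let op_int a p : sigma.-integrable S2 (EFin \o a) ->
  (\int[sigma]_q (K (p, q) * (a \_ S2) q)%:E)%E = (onsager_op a p)%:E /\
  sigma.-integrable setT (fun q => (K (p, q) * (a \_ S2) q)%:E).
Proof.
move=> ia; rewrite onsager_opE.
have iA := integrable_S2_restrict ia.
have iKA : sigma.-integrable setT (fun q => (K (p, q) * (a \_ S2) q)%:E).
  have bk : [bounded K (p, x) | x in [set: T3]].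
    exists 1; split; first exact: num_real.
    by move=> x x1 y _ /=; rewrite (le_trans (onsager_le1 _))// ltW.
  have mKp : measurable_fun setT (fun q => K (p, q)) by exact: measurable_fun_pair2 mK.
  have := integrableMr measurableT mKp bk iA.
  by apply: eq_integrable => // q _ /=; rewrite EFinM.
split=> //; rewrite /Rintegral fineK//.
exact: integrable_fin_num.
Qed.

Let dot3C (p q : T3) : dot3 p q = dot3 q p.
Proof. by rewrite /dot3 ![p.1.1 * _]mulrC ![p.1.2 * _]mulrC ![p.2 * _]mulrC. Qed.

Let int_F1 a b p : sigma.-integrable S2 (EFin \o a) ->
  (\int[sigma]_q F a b (p, q))%E = ((fun p => onsager_op a p * b p) \_ S2 p)%:E.
Proof.
move=> ia; have [E iE] := op_int p ia.
rewrite /F /= [in RHS]patchE.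
under eq_integral do rewrite EFinM.
rewrite integralZr// E -EFinM; congr (_%:E).
by rewrite patchE; case: ifP => //; rewrite mulr0.
Qed.

Let int_F2 a b q : sigma.-integrable S2 (EFin \o b) ->
  (\int[sigma]_p F a b (p, q))%E = ((fun q => a q * onsager_op b q) \_ S2 q)%:E.
Proof.
move=> ib; have [E iE] := op_int q ib.
transitivity (\int[sigma]_p (((a \_ S2) q)%:E * (K (q, p) * (b \_ S2) p)%:E))%E.
  by apply: eq_integral => p _; rewrite /F /K /= dot3C -EFinM; congr (_%:E); ring.
rewrite integralZl// E -EFinM; congr (_%:E).
by rewrite !patchE; case: ifP => //; rewrite mul0r.
Qed.

(** Fubini's theorem and the symmetry of the kernel. *)
Lemma onsager_op_symmetric a b (M : R) : sigma.-integrable S2 (EFin \o a) ->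
  measurable_fun S2 b -> (forall p, S2 p -> `|b p| <= M) ->
  \int[sigma]_(p in S2) (onsager_op a p * b p) =
  \int[sigma]_(q in S2) (a q * onsager_op b q).
Proof.
move=> ia mb bM; rewrite !(Rintegral_mkcond _ S2) /Rintegral; congr fine.
have ib := integrable_sphere mb bM.
have iF := integrableF ia mb bM.
transitivity (\int[sigma]_p \int[sigma]_q F a b (p, q))%E.
  by apply: eq_integral => p _; rewrite int_F1.
by rewrite (Fubini iF); apply: eq_integral => q _; rewrite int_F2.
Qed.

(** A partial integral of the integrable function [F a 1]. *)
Lemma measurable_onsager_op a : sigma.-integrable S2 (EFin \o a) ->
  measurable_fun S2 (onsager_op a).
Proof.
move=> ia.
have m1 : measurable_fun S2 (cst (1 : R) : T3 -> R) by exact: measurable_cst.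
have iF : (sigma \x sigma)%E.-integrable setT (F a (cst 1)).
  by apply: (integrableF (M := 1) ia m1) => p _; rewrite normr1.
have := measurable_funTS (D := S2) (measurable_fubini_F iF).
move=> h; apply/measurable_EFinP; apply: eq_measurable_fun h => p Sp.
by rewrite /fubini_F int_F1// patchE Sp mulr1.
Qed.

Lemma onsager_op_bound a p : sigma.-integrable S2 (EFin \o a) ->
  `|onsager_op a p| <= \int[sigma]_(q in S2) `|a q|.
Proof.
move=> ia.
have iKa : sigma.-integrable S2 (EFin \o (fun q => onsager (dot3 p q) * a q)).
  have bk : [bounded K (p, x) | x in S2].
    exists 1; split; first exact: num_real.
    by move=> x x1 y _ /=; rewrite (le_trans (onsager_le1 _))// ltW.
  have mKp : measurable_fun S2 (fun q => K (p, q)).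
    by apply: measurable_funTS; exact: measurable_fun_pair2 mK.
  have := integrableMr mS2 mKp bk ia.
  by apply: eq_integrable => // q _ /=; rewrite EFinM.
apply: le_trans (le_normr_Rintegral mS2 iKa) _.
apply: le_Rintegral => //; try exact: integrable_norm.
by move=> q _; rewrite normrM ler_piMl// onsager_le1.
Qed.

Lemma interaction_bounded eta : integrableC eta -> boundedC (interaction eta).
Proof.
move=> [ir ii]; apply: (@eq_boundedC _ _ _ (fun q _ => esym (interaction_ReIm eta q))).
split; [exact: measurable_onsager_op..|].
exists (normL1 eta) => q _ /=; split; apply: le_trans (onsager_op_bound _ _) _ => //.
  by rewrite /normL1 lerDl; exact: Rintegral_ge0.
by rewrite /normL1 lerDr; exact: Rintegral_ge0.
Qed.

(** The kernel being real, U is symmetric for the bilinear pairing as well as for the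
    Hermitian one; the bilinear pairing avoids conjugates. *)
Lemma interaction_symmetric eta f : integrableC eta -> boundedC f ->
  sphere_integral (fun p => interaction eta p * f p) =
  sphere_integral (fun q => eta q * interaction f q).
Proof.
move=> ie bf; have [er ei] := ie; have [fr fi [M fM]] := bf.
have bU := interaction_bounded ie.
have Mr p : S2 p -> `|complex.Re (f p)| <= M by move=> /fM[].
have Mi p : S2 p -> `|complex.Im (f p)| <= M by move=> /fM[].
have ifr := integrable_sphere fr Mr.
have ifi := integrable_sphere fi Mi.
have iL a b : sigma.-integrable S2 (EFin \o a) ->
   measurable_fun S2 b -> (forall p, S2 p -> `|b p| <= M) ->
   sigma.-integrable S2 (EFin \o (fun p => onsager_op a p * b p)).
  move=> ia mb bM.
  apply: (@integrable_sphere _ _ ((\int[sigma]_(q in S2) `|a q|) * M)).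
    by apply: measurable_funM => //; exact: measurable_onsager_op.
  by move=> p Sp; rewrite normrM ler_pM// ?bM// onsager_op_bound.
have iR a b : sigma.-integrable S2 (EFin \o a) ->
   measurable_fun S2 b -> (forall p, S2 p -> `|b p| <= M) ->
   sigma.-integrable S2 (EFin \o (fun p => a p * onsager_op b p)).
  move=> ia mb bM.
  have ib := integrable_sphere mb bM.
  have bk : [bounded onsager_op b x | x in S2].
    exists (\int[sigma]_(q in S2) `|b q|); split; first exact: num_real.
    by move=> x x1 y _ /=; rewrite (le_trans (onsager_op_bound _ ib))// ltW.
  have := integrableMl mS2 ia (measurable_onsager_op ib) bk.
  by apply: eq_integrable => // q _ /=; rewrite EFinM.
rewrite /sphere_integral; congr (_ +i* _).
- under eq_Rintegral do rewrite interaction_ReIm RecM /=.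
  under [RHS]eq_Rintegral do rewrite interaction_ReIm RecM /=.
  rewrite RintegralB//; [|exact: iL..].
  rewrite RintegralB//; [|exact: iR..].
  by rewrite !(onsager_op_symmetric (M := M)).
- under eq_Rintegral do rewrite interaction_ReIm ImcM /=.
  under [RHS]eq_Rintegral do rewrite interaction_ReIm ImcM /=.
  rewrite RintegralD//; [|exact: iL..].
  rewrite RintegralD//; [|exact: iR..].
  by rewrite !(onsager_op_symmetric (M := M)).
Qed.

End OnsagerOperator.

(** * Completeness of the spherical harmonics *)

Section Completeness.
Context {R : realType}.
Local Notation T3 := (R * R * R)%type.
Local Notation C := R[i].
Implicit Types (eta f g w : T3 -> C).

Lemma rodr_coef s n i : (rodr s)^`N(s + n)`_i = (@rodr R s)`_(s + n + i) *+ 'C(s + n + i, s + n).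
Proof. by rewrite coef_nderivn. Qed.

Lemma rodr_lead s : (@rodr R s)`_(2 * s) = 1.
Proof.
have : lead_coef (@rodr R s) = 1.
  rewrite /rodr lead_coef_exp lead_coefDl ?lead_coefXn ?expr1n//.
  by rewrite size_polyN size_poly1 size_polyXn.
by rewrite lead_coefE size_rodr.
Qed.

(** The polynomials tested in the hypothesis have exact degrees s - n = 0, 1, 2, ...,
    so that they span all polynomials. *)
Let span_axis eta w (n : nat) : integrableC eta -> boundedC w ->
  (forall s, (n <= s)%N ->
     sphere_integral (fun q => w q ^+ n * ((rodr s)^`N(s + n).[q.2])%:C * eta q) = 0) ->
  forall r : {poly R},
     sphere_integral (fun q => w q ^+ n * (r.[q.2])%:C * eta q) = 0.
Proof.
move=> ie bw H r.
have bwr (p : {poly R}) : boundedC (fun q => w q ^+ n * (p.[q.2])%:C).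
  by apply: boundedCM; [exact: boundedCX|exact/boundedC_poly/boundedC_zc].
suff : forall d (p : {poly R}), (size p <= d)%N ->
     sphere_integral (fun q => w q ^+ n * (p.[q.2])%:C * eta q) = 0.
  by apply.
elim=> [p|d IH p sp].
  rewrite leqn0 size_poly_eq0 => /eqP ->; rewrite -[RHS](@sphere_integral0 R).
  by apply: eq_sphere_integral => q _; rewrite horner0 rmorph0 mulr0 mul0r.
pose Q : {poly R} := (rodr (n + d))^`N(n + d + n).
have Qd i : (d <= i)%N -> Q`_i = if i == d then 'C(2 * (n + d), n + d + n)%:R else 0.
  move=> di; rewrite /Q rodr_coef; case: eqP => [->|ne].
    have E : (n + d + n + d = 2 * (n + d))%N by lia.
    by rewrite E rodr_lead.
  by rewrite nth_default ?mul0rn// size_rodr; lia.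
pose c := p`_d / Q`_d.
have Qd0 : Q`_d != 0.
  by rewrite Qd// eqxx pnatr_eq0 -lt0n bin_gt0; lia.
have szr : (size (p - c *: Q)%R <= d)%N.
  apply/leq_sizeP => i di; rewrite coefB coefZ /c.
  move: di; rewrite leq_eqVlt => /orP[/eqP <-|di]; first by rewrite divfK// subrr.
  rewrite (Qd i (ltnW di)) gtn_eqF// mulr0 subr0.
  by rewrite nth_default//; exact: leq_trans sp di.
have -> : sphere_integral (fun q => w q ^+ n * (p.[q.2])%:C * eta q) =
   sphere_integral (fun q => w q ^+ n * ((p - c *: Q).[q.2])%:C * eta q +
     c%:C * (w q ^+ n * (Q.[q.2])%:C * eta q)).
  apply: eq_sphere_integral => q _.
  by rewrite hornerD hornerN hornerZ rmorphB rmorphM /=; ring.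
have i1 (p' : {poly R}) : integrableC (fun q => w q ^+ n * (p'.[q.2])%:C * eta q).
  exact: integrableCMl.
rewrite sphere_integralD//; last exact: integrableCZ.
by rewrite IH// sphere_integralZ// H ?mulr0 ?addr0// leq_addr.
Qed.

(** By [harm_upper], [harm_lower] and [span_axis], eta is orthogonal to u^n r(z) and
    ubar^n r(z) for all polynomials r. Since u ubar = 1 - z^2 on the sphere, every
    monomial in u, ubar and z is of one of these two forms. *)
Lemma orthogonal_dot3_pow eta : integrableC eta ->
  (forall s k, (k <= 2 * s)%N -> sphere_integral (fun q => eta q * harm s k q) = 0) ->
  forall p m, sphere_integral (fun q => (dot3 p q)%:C ^+ m * eta q) = 0.
Proof.
move=> ie H p m.
have i0 : ('i%R : C) != 0 := neq0Ci _.
have two : (2 : C) != 0 by rewrite pnatr_eq0.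
have Hu n r : sphere_integral (fun q => uc q ^+ n * (r.[q.2])%:C * eta q) = 0.
  apply: span_axis => //; first exact: boundedC_uc.
  move=> s ns; have ks : (s + n <= 2 * s)%N by lia.
  have e0 := H s (s + n)%N ks.
  have ->: sphere_integral (fun q => uc q ^+ n * ((rodr s)^`N(s + n).[q.2])%:C * eta q) =
     sphere_integral (fun q => (2 ^+ s / 'i%R ^+ n) * (eta q * harm s (s + n) q)).
    apply: eq_sphere_integral => q Sq; rewrite harm_upper// exprMn; field.
    by rewrite !expf_neq0.
  rewrite sphere_integralZ ?e0 ?mulr0//; apply: integrableCM => //; exact: boundedC_harm.
have Hub n r : sphere_integral (fun q => ubar q ^+ n * (r.[q.2])%:C * eta q) = 0.
  apply: span_axis => //; first exact: boundedC_ubar.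
  move=> s ns; have ks : (s - n <= 2 * s)%N by lia.
  have e0 := H s (s - n)%N ks.
  have ->: sphere_integral (fun q => ubar q ^+ n * ((rodr s)^`N(s + n).[q.2])%:C * eta q) =
     sphere_integral (fun q => (2 ^+ s / 'i%R ^+ n) * (eta q * harm s (s - n) q)).
    apply: eq_sphere_integral => q Sq; rewrite harm_lower// exprMn; field.
    by rewrite !expf_neq0.
  rewrite sphere_integralZ ?e0 ?mulr0//; apply: integrableCM => //; exact: boundedC_harm.
have Hm a b c : sphere_integral (fun q => uc q ^+ a * ubar q ^+ b * zc q ^+ c * eta q) = 0.
  have rE e : forall q : T3, (((1 - 'X^2) ^+ e * 'X^c : {poly R}).[q.2])%:C =
      (1 - zc q ^+ 2) ^+ e * zc q ^+ c.
    move=> q; rewrite hornerM horner_exp !hornerE.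
    by rewrite rmorphM !rmorphXn rmorphB rmorphXn rmorph1.
  have uz (q : T3) : S2 q -> uc q * ubar q = 1 - zc q ^+ 2.
    by move=> /sphere_eq <-; rewrite addrK.
  case: (leqP b a) => ba.
    rewrite -(Hu (a - b)%N ((1 - 'X^2) ^+ b * 'X^c)).
    apply: eq_sphere_integral => q Sq; rewrite rE -uz// exprMn -{1}(subnK ba) exprD.
    ring.
  rewrite -(Hub (b - a)%N ((1 - 'X^2) ^+ a * 'X^c)).
  apply: eq_sphere_integral => q Sq.
  by rewrite rE -uz// exprMn -{1}(subnK (ltnW ba)) exprD; ring.
have im a b c : integrableC (fun q => uc q ^+ a * ubar q ^+ b * zc q ^+ c * eta q).
  apply: integrableCMl => //; apply: boundedCM; last exact/boundedCX/boundedC_zc.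
  by apply: boundedCM; apply: boundedCX; [exact: boundedC_uc|exact: boundedC_ubar].
under eq_sphere_integral do rewrite dot3E linform_pow mulr_suml.
rewrite sphere_integral_sum; last first.
  move=> i; apply: (@eq_integrableC _ (fun q => \sum_(j < i.+1)
    ('C(m, i)%:R * 'C(i, j)%:R * (ubar p / 2) ^+ (i - j) * (uc p / 2) ^+ j * zc p ^+ (m - i)) *
    (uc q ^+ (i - j) * ubar q ^+ j * zc q ^+ (m - i) * eta q))).
    by move=> q _; rewrite mulr_suml; apply: eq_bigr => j _; rewrite !mulrA.
  by apply: integrableC_sum => j; exact: integrableCZ.
rewrite big1// => i _.
transitivity (sphere_integral (fun q => \sum_(j < i.+1)
    ('C(m, i)%:R * 'C(i, j)%:R * (ubar p / 2) ^+ (i - j) * (uc p / 2) ^+ j * zc p ^+ (m - i)) *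
    (uc q ^+ (i - j) * ubar q ^+ j * zc q ^+ (m - i) * eta q))).
  apply: eq_sphere_integral => q _.
  by rewrite mulr_suml; apply: eq_bigr => j _; rewrite !mulrA.
rewrite sphere_integral_sum; last by move=> j; exact: integrableCZ.
by rewrite big1// => j _; rewrite sphere_integralZ// Hm mulr0.
Qed.

End Completeness.

(** * Eigenfunctions and eigenspaces *)

Section Eigenfunctions.
Context {R : realType}.
Local Notation sigma := (@surface_measure R).
Local Notation T3 := (R * R * R)%type.
Local Notation C := R[i].
Implicit Types (eta f g : T3 -> C).

Let mS2 := @measurable_S2 R.

Lemma interaction_harm s k (p : T3) : S2 p -> (k <= 2 * s)%N ->
  interaction (harm s k) p = (mu_O s)%:C * harm s k p.
Proof.
by move=> Sp ks; rewrite funk_hecke_onsager// interaction_pole mu_O_legendre.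
Qed.

Lemma interaction_linear f g c (p : T3) : integrableC f -> integrableC g ->
  interaction (fun q => f q + c * g q) p = interaction f p + c * interaction g p.
Proof.
move=> iF iG; rewrite /interaction.
have bo := boundedC_onsager p.
rewrite -sphere_integralZ; last exact: integrableCMl.
rewrite -sphere_integralD; [|exact: integrableCMl|exact/integrableCZ/integrableCMl].
by apply: eq_sphere_integral => q _; ring.
Qed.

Lemma ae_eq_sphere_integral f g : integrableC f -> integrableC g -> ae_eqS2 f g ->
  sphere_integral f = sphere_integral g.
Proof.
move=> [fr fi] [gr gi] fg; rewrite /sphere_integral /Rintegral.
congr (fine _ +i* fine _); apply: ae_eq_integral => //.
- exact: measurable_int fr.
- exact: measurable_int gr.
- by apply: filterS fg => q h Sq; rewrite /= h.
- exact: measurable_int fi.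
- exact: measurable_int gi.
- by apply: filterS fg => q h Sq; rewrite /= h.
Qed.

(** The measure is finite and |a| <= 1 + a^2. *)
Lemma L2S2_integrable f : L2S2 f -> integrableC f.
Proof.
move=> [mr mi fin].
have msq : measurable_fun S2 (fun q => (complex.Re (f q)) ^+ 2 + (complex.Im (f q)) ^+ 2).
  by apply: measurable_funD; exact: measurable_funX.
have isq : sigma.-integrable S2 (EFin \o (fun q => complex.Re (f q) ^+ 2 + complex.Im (f q) ^+ 2)).
  apply/integrableP; split; first exact/measurable_EFinP.
  apply: le_lt_trans fin; rewrite le_eqVlt; apply/orP; left; apply/eqP.
  by apply: eq_integral => q _ /=; rewrite ger0_norm// addr_ge0 ?sqr_ge0.
have i1 : sigma.-integrable S2 (EFin \o (fun=> 1 : R)).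
  by have [] := boundedC_integrable (boundedC_cst (1 : C)).
have i2 := integrableD mS2 i1 isq.
have key (a b : R) : `|a| <= `|1 + (a ^+ 2 + b ^+ 2)|.
  rewrite [leRHS]ger0_norm ?addr_ge0 ?sqr_ge0//.
  have := sqr_ge0 (`|a| - 1); rewrite sqrrB real_normK ?num_real// => h.
  have := sqr_ge0 b; have := normr_ge0 a; rewrite -mulr_natl mulr1 in h; lra.
split; apply: (le_integrable mS2 _ _ i2).
- exact/measurable_EFinP.
- by move=> q _ /=; rewrite lee_fin key.
- exact/measurable_EFinP.
- by move=> q _ /=; rewrite lee_fin (addrC (complex.Re _ ^+ 2)) key.
Qed.

Lemma bounded_L2S2 f : boundedC f -> L2S2 f.
Proof.
move=> [mr mi [M fM]]; split=> //.
have : sigma.-integrable S2 (EFin \o (fun q => complex.Re (f q) ^+ 2 + complex.Im (f q) ^+ 2)).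
  apply: (@integrable_sphere _ _ (M ^+ 2 + M ^+ 2)).
    by apply: measurable_funD; exact: measurable_funX.
  move=> q /fM[h1 h2]; rewrite ger0_norm ?addr_ge0 ?sqr_ge0//.
  by rewrite lerD// -real_normK ?num_real// lerXn2r// nnegrE (le_trans _ h1).
by move=> /integrable_lty; exact.
Qed.

(** By the symmetry of U, the pairing of U f with the harmonic is both lambda times and
    mu_O s times the pairing of f with it. *)
Lemma eigen_orthogonal (lambda : C) f s k : integrableC f ->
  ae_eqS2 (interaction f) (fun p => lambda * f p) -> (k <= 2 * s)%N ->
  lambda != (mu_O s)%:C -> sphere_integral (fun q => f q * harm s k q) = 0.
Proof.
move=> iF ef ks ne.
have bh := @boundedC_harm R s k.
have ifh : integrableC (fun q => f q * harm s k q) by exact: integrableCM.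
have e1 : sphere_integral (fun p => interaction f p * harm s k p) =
    lambda * sphere_integral (fun q => f q * harm s k q).
  rewrite -sphere_integralZ//; apply: ae_eq_sphere_integral.
  - by apply: integrableCM => //; exact/boundedC_integrable/interaction_bounded.
  - exact: integrableCZ.
  - by apply: filterS ef => q h Sq; rewrite h// mulrA.
have e2 : sphere_integral (fun p => interaction f p * harm s k p) =
    (mu_O s)%:C * sphere_integral (fun q => f q * harm s k q).
  rewrite interaction_symmetric// -sphere_integralZ//.
  by apply: eq_sphere_integral => q Sq; rewrite interaction_harm//; ring.
have /eqP := etrans (esym e1) e2.
by rewrite -subr_eq0 -mulrBl mulf_eq0 subr_eq0 (negbTE ne) => /eqP.
Qed.

(** f is orthogonal to all powers of p . q, hence to the kernel: lambda f = U f = 0. *)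
Lemma eigen_trivial (lambda : C) f : lambda != 0 -> integrableC f ->
  ae_eqS2 (interaction f) (fun p => lambda * f p) ->
  (forall s k, (k <= 2 * s)%N -> sphere_integral (fun q => f q * harm s k q) = 0) ->
  ae_eqS2 f (fun=> 0).
Proof.
move=> l0 iF ef H; apply: filterS ef => q h Sq.
have U0 : interaction f q = 0.
  by apply: interaction_eq0 => // m; exact: orthogonal_dot3_pow.
have /eqP := h Sq; rewrite U0 eq_sym mulf_eq0 (negbTE l0) => /eqP ->//.
Qed.

(** The pairing with the harmonic of opposite order is nonzero. *)
Lemma harm_not_ae0 s k : (k <= 2 * s)%N -> ~ ae_eqS2 (@harm R s k) (fun=> 0).
Proof.
move=> ks h0.
have ks' : (k < (2 * s).+1)%N by [].
have ls : (2 * s - k < (2 * s).+1)%N by lia.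
have := gram_harm ks' ls; rewrite subnKC// eqxx => E.
have : sphere_integral (fun q => @harm R s k q * harm s (2 * s - k) q) = 0.
  rewrite -[RHS](@sphere_integral0 R); apply: ae_eq_sphere_integral.
  - by apply/boundedC_integrable/boundedCM; exact: boundedC_harm.
  - exact/boundedC_integrable/boundedC_cst.
  - by apply: filterS h0 => q h Sq; rewrite h// mul0r.
apply/eqP; rewrite E mulf_neq0 ?gram_cst_neq0// mulf_neq0 ?signr_eq0//.
by rewrite pnatr_eq0 -lt0n bin_gt0.
Qed.

Lemma eigenfunction_Ylm s k : (k <= 2 * s)%N ->
  eigenfunction (mu_O s)%:C (@Ylm R s (k%:Z - s%:Z)) /\
  (forall p : T3, S2 p -> interaction (Ylm s (k%:Z - s%:Z)) p =
     (mu_O s)%:C * Ylm s (k%:Z - s%:Z) p).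
Proof.
move=> ks; set Y := Ylm s _.
have YE q : S2 q -> Y q = Ylm_cst s k * harm s k q by move=> Sq; exact: Ylm_harm.
have bY : boundedC Y.
  apply: (@eq_boundedC _ _ _ (fun q Sq => esym (YE q Sq))).
  by apply: boundedCZ; exact: boundedC_harm.
have UY (p : T3) : S2 p -> interaction Y p = (mu_O s)%:C * Y p.
  move=> Sp; rewrite YE// mulrCA -interaction_harm// /interaction -sphere_integralZ.
    by apply: eq_sphere_integral => q Sq; rewrite YE//; ring.
  apply: boundedC_integrable.
  by apply: boundedCM; [exact: boundedC_onsager|exact: boundedC_harm].
split=> //; split; first exact: bounded_L2S2.
- move=> h0; apply: (@harm_not_ae0 s k ks); apply: filterS h0 => q h Sq.
  have /eqP := h Sq; rewrite YE// mulf_eq0 (negbTE (Ylm_cst_neq0 ks)) => /eqP ->//.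
- by apply: aeW => q Sq; exact: UY.
Qed.

(** Subtract from eta its component of degree s. The remainder f still satisfies
    U f = lambda f; it is orthogonal to the harmonics of degree s by the choice of
    the coefficients, and to those of the other degrees because their eigenvalues
    differ from lambda. Hence it vanishes. *)
Lemma eigenspace (lambda : C) eta : lambda != 0 -> eigenfunction lambda eta ->
  exists2 s : nat, ~~ odd s /\ lambda = (mu_O s)%:C &
   exists c : 'I_(2 * s).+1 -> C, ae_eqS2 eta (fun p =>
      \sum_(i < (2 * s).+1) c i * Ylm s (i%:Z - s%:Z) p).
Proof.
move=> l0 [/L2S2_integrable ie ne0 ev].
have [[s sl]|nos] := pselect (exists s, lambda = (mu_O s)%:C); last first.
  exfalso; apply: ne0; apply: (eigen_trivial l0 ie ev) => s k ks.
  by apply: (eigen_orthogonal ie ev ks); apply/eqP => E; apply: nos; exists s.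
have mu0 : mu_O s != 0 :> R.
  by apply: contraNneq l0 => E; rewrite sl E.
have os : ~~ odd s by apply: contraNN mu0 => /mu_O_odd ->.
exists s => //.
(* the Gram matrix pairs the index i with 2 * s - i only *)
pose d (i : 'I_(2 * s).+1) : C :=
  sphere_integral (fun q => eta q * harm s (2 * s - i) q) /
  sphere_integral (fun q => harm s i q * harm s (2 * s - i) q).
pose S q := \sum_(i < (2 * s).+1) d i * harm s i q.
have bS : boundedC S.
  by apply: boundedC_sum => i; apply: boundedCZ; exact: boundedC_harm.
pose f q := eta q + -1 * S q.
have iS := boundedC_integrable bS.
have iF : integrableC f by apply: integrableCD => //; exact: integrableCZ.
have US (p : T3) : S2 p -> interaction S p = lambda * S p.
  move=> Sp.
  have bo := boundedC_onsager p.
  rewrite /interaction.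
  transitivity (sphere_integral (fun q => \sum_(i < (2 * s).+1)
     d i * ((onsager (dot3 p q))%:C * harm s i q))).
    apply: eq_sphere_integral => q _; rewrite /S mulr_sumr.
    by apply: eq_bigr => i _; rewrite mulrCA.
  have io (i : 'I_(2 * s).+1) : integrableC (fun q => (onsager (dot3 p q))%:C * harm s i q).
    by apply/boundedC_integrable/boundedCM => //; exact: boundedC_harm.
  rewrite sphere_integral_sum; last by move=> i; exact: integrableCZ.
  rewrite /S mulr_sumr; apply: eq_bigr => i _.
  rewrite sphere_integralZ// -/(interaction (harm s i) p) interaction_harm// -?sl.
    by rewrite mulrCA.
  by rewrite -ltnS.
have evf : ae_eqS2 (interaction f) (fun p => lambda * f p).
  apply: filterS ev => q h Sq; rewrite /f interaction_linear// h// US//; ring.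
have f0 : ae_eqS2 f (fun=> 0).
  apply: (eigen_trivial l0 iF evf) => t l lt.
  have [E|ne] := eqVneq lambda (mu_O t)%:C; last exact: (eigen_orthogonal iF evf lt).
  have st : s = t.
    by apply: (@mu_O_inj R) => //; apply: (@complexI R); rewrite -sl.
  move: lt; rewrite -st {t E st} => lt.
  have bl := @boundedC_harm R s l.
  transitivity (sphere_integral (fun q => eta q * harm s l q) -
    \sum_(i < (2 * s).+1) d i * sphere_integral (fun q => harm s i q * harm s l q)).
    have ii (i : 'I_(2 * s).+1) : integrableC (fun q => harm s i q * harm s l q).
      by apply/boundedC_integrable/boundedCM => //; exact: boundedC_harm.
    transitivity (sphere_integral (fun q => eta q * harm s l q +
       -1 * \sum_(i < (2 * s).+1) d i * (harm s i q * harm s l q))).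
      apply: eq_sphere_integral => q _; rewrite /f /S mulrDl -mulrA; congr (_ + -1 * _).
      by rewrite mulr_suml; apply: eq_bigr => i _; rewrite mulrA.
    have isum : integrableC (fun q => \sum_(i < (2 * s).+1) d i * (harm s i q * harm s l q)).
      by apply: integrableC_sum => i; exact: integrableCZ.
    rewrite sphere_integralD; [|exact: integrableCM|exact: integrableCZ].
    rewrite sphere_integralZ// mulN1r sphere_integral_sum; last first.
      by move=> i; exact: integrableCZ.
    by congr (_ - _); apply: eq_bigr => i _; rewrite sphere_integralZ.
  have ls : (2 * s - l < (2 * s).+1)%N by lia.
  have lt' : (l < (2 * s).+1)%N by [].
  rewrite (bigD1 (Ordinal ls)) //= big1 ?addr0 => [|i].
    rewrite /d /= subKn// divfK ?subrr//.
    rewrite (gram_harm ls lt') subnK// eqxx mulf_neq0 ?gram_cst_neq0//.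
    by rewrite mulf_neq0 ?signr_eq0// pnatr_eq0 -lt0n bin_gt0; lia.
  rewrite -val_eqE /= => ne; rewrite (gram_harm (ltn_ord i) lt').
  case: eqP => [E|_]; last by rewrite mulr0.
  by exfalso; move/eqP: ne; apply; lia.
exists (fun i => d i / Ylm_cst s i).
apply: filterS f0 => q h Sq; have := h Sq; rewrite /f mulN1r => /eqP.
rewrite subr_eq0 => /eqP ->; apply: eq_bigr => i _.
have is2 : (i <= 2 * s)%N by rewrite -ltnS.
by rewrite Ylm_harm// mulrA divfK// Ylm_cst_neq0.
Qed.

End Eigenfunctions.

Theorem corollary10 (R : realType) :
  [/\ (forall (s : nat) (n : int), - s%:Z <= n <= s%:Z ->
         eigenfunction (mu_O s)%:C (@Ylm R s n) /\
         (forall p : R * R * R, S2 p ->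
            interaction (Ylm s n) p = (mu_O s)%:C * Ylm s n p)),
      (forall lambda : R[i],
         (exists eta : R * R * R -> R[i], eigenfunction lambda eta) <->
         (exists s : nat, lambda = (mu_O s)%:C)) &
      (forall (lambda : R[i]) (eta : R * R * R -> R[i]),
         lambda != 0 -> eigenfunction lambda eta ->
         exists2 s : nat, ~~ odd s /\ lambda = (mu_O s)%:C &
           exists c : 'I_(2 * s).+1 -> R[i],
             ae_eqS2 eta (fun p =>
               \sum_(i < (2 * s).+1) c i * Ylm s (i%:Z - s%:Z) p))].
Proof.
split.
- by move=> s n /Ylm_index[k ks ->]; exact: eigenfunction_Ylm.
- move=> lambda; split=> [[eta ev]|[s ->]].
    have [->|l0] := eqVneq lambda 0; first by exists 1%N; rewrite mu_O_odd.
    by have [s [_ ->] _] := eigenspace l0 ev; exists s.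
  have s2 : (s <= 2 * s)%N by lia.
  by exists (@Ylm R s (s%:Z - s%:Z)); have [] := @eigenfunction_Ylm R _ _ s2.
- by move=> lambda eta l0 ev; exact: eigenspace.
Qed.
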